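(* Let $\star\in\{a,b,c,d,e,f\}$, let $T=[v_1,v_2,v_3]\subset\mathbb{R}^2$ be a nondegenerate triangle with 12-split $T_{12}$, and let $\mathcal{B}_\star=\{S_1,\dots,S_{39}\}$ be the basis of $\mathcal{S}^3_5(T_{12})$ with domain points $\xi_1,\dots,\xi_{39}$ defined in the context. Let $K_\star>0$ be a stability constant of $\mathcal{B}_\star$ independent of the geometry of $T$, i.e. such that $K_\star^{-1}\|\boldsymbol b\|_\infty\le\|\sum_ib_iS_i\|_{L_\infty(T)}\le\|\boldsymbol b\|_\infty$ for all $\boldsymbol b\in\mathbb{R}^{39}$. Let $h$ be the length of the longest edge of $T$, and let $f=\sum_{i=1}^{39}c_iS_i$, $\boldsymbol c=(c_1,\dots,c_{39})^{\mathsf T}\in\mathbb{R}^{39}$, with Hessian matrix $H$ and values $\boldsymbol f=(f(\xi_1),\dots,f(\xi_{39}))^{\mathsf T}$. Then $$\|\boldsymbol c-\boldsymbol f\|_\infty\le 2K_\star h^2\max_{x\in T}\|H(x)\|_\infty .$$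
   Context: **12-split.** Let $v_4=\frac{v_1+v_2}2$, $v_5=\frac{v_2+v_3}2$, $v_6=\frac{v_1+v_3}2$, $v_7=\frac{v_4+v_6}2$, $v_8=\frac{v_4+v_5}2$, $v_9=\frac{v_5+v_6}2$, $v_{10}=\frac{v_1+v_2+v_3}3$. The 12-split $T_{12}$ is the triangulation of $T$ into 12 triangles obtained by drawing the segments $[v_1,v_5],[v_2,v_6],[v_3,v_4],[v_4,v_5],[v_5,v_6],[v_4,v_6]$; its vertices are $v_1,\dots,v_{10}$. $\mathcal{S}^3_5(T_{12})$ is the space of $C^3$ functions on $T$ that are polynomials of total degree at most 5 on each of the 12 triangles; it has dimension 39. $\|H(x)\|_\infty$ is the matrix infinity norm (maximum absolute row sum). **Simplex splines.** For a finite multiset $K=\{v_1^{m_1}\cdots v_{10}^{m_{10}}\}$ let $|K|=\sum m_i$ and $[K]$ its convex hull. For $x$ not on any line through two of the points $v_1,\dots,v_{10}$, define recursively $Q[K](x)=0$ if $\mathrm{area}([K])=0$; $Q[K](x)=\mathbf 1_{[K]}(x)\,\mathrm{area}(T)/\mathrm{area}([K])$ if $\mathrm{area}([K])\ne0$ and $|K|=3$; and $Q[K](x)=\sum_{j=1}^{10}\beta_jQ[K\setminus v_j](x)$ if $\mathrm{area}([K])\neq 0$ and $|K|>3$, where $x=\sum_j\beta_jv_j$, $\sum_j\beta_j=1$, $\beta_j=0$ whenever $m_j=0$, and $K\setminus v_j$ removes one copy of $v_j$ (the value does not depend on the choice of the $\beta_j$). On $T$ the function $Q[K]$ is extended by continuity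 (possible for all simplex splines used here). Write $Q_{ijklmn}:=Q[v_1^iv_2^jv_3^kv_4^lv_5^mv_6^n]$. **The bases, dual points and domain points.** Each permutation of $v_1,v_2,v_3$ extends to an affine map of $T$ permuting $v_1,\dots,v_{10}$; this gives a group $S_3$ of permutations $\sigma$. Each basis below (39 functions, order immaterial) is described by representatives $(wQ[K];P)$, where $P$ is a multiset of five ''dual points''; the basis consists of all the functions $wQ[\sigma(K)]$, $\sigma\in S_3$, with dual points $\sigma(P)$. The domain point of a basis function is the average of its five dual points. All six bases contain the orbits of $(\frac14Q_{600101};v_1^5)$, $(\frac14Q_{500201};v_1^4v_4)$, $(\frac12Q_{410201};v_1^3v_4^2)$, $(Q_{141110};v_2^3v_4v_5)$, $(\frac12Q_{131210};v_1v_2^2v_4v_5)$. In addition: - $\mathcal{B}_a$: $(\frac12Q_{320201};v_1^2v_2v_4^2)$, $(\frac34Q_{222110};v_1v_2^2v_3v_{10})$, $(\frac34Q_{221210};v_1v_2^2v_4v_{10})$. - $\mathcal{B}_b$: $(\frac12Q_{320201};v_1^2v_2v_4^2)$, $(\frac34Q_{221111};v_1v_2v_3v_4v_{10})$, $(\frac34Q_{221210};v_1v_2^2v_4v_{10})$. - $\mathcal{B}_c$: $(\frac12Q_{320201};v_1^2v_2v_4^2)$, $(\frac34Q_{220211};v_1v_2v_4^2v_{10})$, $(\frac34Q_{121211};v_1v_2v_4v_5v_{10})$. - $\mathcal{B}_d$: $(Q_{321200};v_1^2v_2v_4^2)$, $(\frac34Q_{222110};v_1v_2^2v_3v_{10})$,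 $(\frac14Q_{221210};v_1v_2^2v_3v_4)$. - $\mathcal{B}_e$: $(Q_{321200};v_1^2v_2v_4^2)$, $(\frac34Q_{221111};v_1v_2v_3v_4v_{10})$, $(\frac14Q_{221210};v_1v_2^2v_3v_4)$. - $\mathcal{B}_f$: $(Q_{321200};v_1^2v_2v_4^2)$, $(\frac14Q_{220211};v_1v_2v_3v_4^2)$, $(\frac12Q_{121211};v_1v_2v_3v_4v_8)$. *)

(* Defs.v *)
From HB Require Import structures.
From mathcomp Require Import all_boot all_order all_algebra.
From mathcomp Require Import all_classical all_reals all_analysis.

Set Implicit Arguments.
Unset Strict Implicit.
Unset Printing Implicit Defensive.

Import Order.TTheory GRing.Theory Num.Theory numFieldNormedType.Exports.

Local Open Scope classical_set_scope.
Local Open Scope ring_scope.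

(* The plane is R * R.  Its library norm is the max norm, hence the explicit
   Euclidean distance below. *)

Definition eucl_dist {R : realType} (x y : R * R) : R :=
  Num.sqrt ((x.1 - y.1) ^+ 2 + (x.2 - y.2) ^+ 2).

Definition nondegenerate_triangle {R : realType} (v1 v2 v3 : R * R) : Prop :=
  free [:: v2 - v1; v3 - v1].

Definition longest_edge {R : realType} (v1 v2 v3 : R * R) : R :=
  Num.max (eucl_dist v1 v2) (Num.max (eucl_dist v2 v3) (eucl_dist v1 v3)).

Definition lebesgue2 {R : realType} :=
  (@lebesgue_measure R \x @lebesgue_measure R)%E.

Definition area {R : realType} (A : set (R * R)) : R := fine (lebesgue2 A).

(* Labels 1, ..., 10 of the vertices of the 12-split; other labels are junk. *)
Definition split12 {R : realType} (v1 v2 v3 : R * R) (j : nat) : R * R :=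
  let mid (x y : R * R) := 2^-1 *: (x + y) in
  let v4 := mid v1 v2 in
  let v5 := mid v2 v3 in
  let v6 := mid v1 v3 in
  match j with
  | 1%N => v1 | 2%N => v2 | 3%N => v3
  | 4%N => v4 | 5%N => v5 | 6%N => v6
  | 7%N => mid v4 v6 | 8%N => mid v4 v5 | 9%N => mid v5 v6
  | 10%N => 3^-1 *: (v1 + v2 + v3)
  | _ => 0
  end.

(* A finite multiset of vertices is a sequence of labels, up to order.  In the
   definitions below, v maps labels to points. *)

Definition hull {R : realType} (v : nat -> R * R) (K : seq nat) : set (R * R) :=
  [set x | exists a : nat -> R,
    [/\ forall j, 0 <= a j,
        \sum_(j <- undup K) a j = 1 &
        \sum_(j <- undup K) a j *: v j = x]].

Definition triangle {R : realType} (v : nat -> R * R) : set (R * R) :=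
  hull v [:: 1; 2; 3]%N.

Definition off_lines {R : realType} (v : nat -> R * R) : set (R * R) :=
  [set x | forall i j : nat, (0 < i < j)%N -> (j <= 10)%N ->
    ~ exists t : R, x = v i + t *: (v j - v i)].

Definition affine_coords {R : realType} (v : nat -> R * R) (K : seq nat)
    (x : R * R) : set (nat -> R) :=
  [set b | [/\ \sum_(1 <= j < 11) b j *: v j = x,
               \sum_(1 <= j < 11) b j = 1 &
               forall j, j \notin K -> b j = 0]].

(* n bounds the number of recursion steps: |K| = n + 3.  The coefficients are
   picked by [get] in the set of admissible ones. *)
Fixpoint simplex_spline_rec {R : realType} (v : nat -> R * R) (n : nat)
    (K : seq nat) (x : R * R) : R :=
  if area (hull v K) == 0 then 0 else
  match n with
  | 0%N => \1_(hull v K) x * (area (triangle v) / area (hull v K))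
  | n'.+1 => let b := get (affine_coords v K x) in
      \sum_(1 <= j < 11) b j * simplex_spline_rec v n' (rem j K) x
  end.

(* Meaningful for x in [off_lines v]. *)
Definition simplex_spline {R : realType} (v : nat -> R * R) (K : seq nat)
    (x : R * R) : R :=
  simplex_spline_rec v (size K - 3) K x.

(* Extension by continuity to the triangle. *)
Definition simplex_spline_on {R : realType} (v : nat -> R * R) (K : seq nat)
    (x : R * R) : R :=
  lim (simplex_spline v K y
         @[y --> within (triangle v `&` off_lines v) (nbhs x)]).

(* Q_{ijklmn} is the simplex spline with the following knots. *)
Definition knots (i j k l m n : nat) : seq nat :=
  nseq i 1%N ++ nseq j 2%N ++ nseq k 3%N ++
  nseq l 4%N ++ nseq m 5%N ++ nseq n 6%N.

(* The symmetries of the 12-split: the j-th entry of a sequence (counted from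
   1) is the image of the label j; see [symmetriesP]. *)
Definition symmetries : seq (seq nat) :=
  [:: [:: 1; 2; 3; 4; 5; 6; 7; 8; 9; 10];
      [:: 1; 3; 2; 6; 5; 4; 7; 9; 8; 10];
      [:: 2; 1; 3; 4; 6; 5; 8; 7; 9; 10];
      [:: 2; 3; 1; 5; 6; 4; 8; 9; 7; 10];
      [:: 3; 1; 2; 6; 4; 5; 9; 7; 8; 10];
      [:: 3; 2; 1; 5; 4; 6; 9; 8; 7; 10]]%N.

Definition relabel (s : seq nat) (j : nat) : nat := nth 0%N (0%N :: s) j.

Lemma symmetries_all :
  perm_eq [seq take 3 s | s <- symmetries] (permutations [:: 1; 2; 3]%N).
Proof. by []. Qed.

Lemma symmetriesP {R : realType} (v1 v2 v3 : R * R) (s : seq nat) (j : nat) :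
  s \in symmetries -> (0 < j <= 10)%N ->
  let v := split12 v1 v2 v3 in
  split12 (v (relabel s 1)) (v (relabel s 2)) (v (relabel s 3)) j
  = v (relabel s j).
Proof.
rewrite !inE => /orP[|/orP[|/orP[|/orP[|/orP[|]]]]] /eqP ->;
  case: j => [//|[|[|[|[|[|[|[|[|[|[|//]]]]]]]]]]] _ //=;
  rewrite /relabel /= ?(addrC v2 v1) ?(addrC v3 v1) ?(addrC v3 v2) //;
  congr (_ *: _); by [exact: addrC | rewrite addrAC | rewrite [LHS]addrC addrA].
Qed.

Variant basis_name := Ba | Bb | Bc | Bd | Be | Bf.

(* A weighted simplex spline w Q[K] with its dual points P is encoded by the
   triple (w, K, P), where K and P are sequences of labels. *)
Definition common_reps {R : realType} : seq (R * seq nat * seq nat) :=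
  [:: (1 / 4, knots 6 0 0 1 0 1, [:: 1; 1; 1; 1; 1]%N);
      (1 / 4, knots 5 0 0 2 0 1, [:: 1; 1; 1; 1; 4]%N);
      (1 / 2, knots 4 1 0 2 0 1, [:: 1; 1; 1; 4; 4]%N);
      (1, knots 1 4 1 1 1 0, [:: 2; 2; 2; 4; 5]%N);
      (1 / 2, knots 1 3 1 2 1 0, [:: 1; 2; 2; 4; 5]%N)].

Definition specific_reps {R : realType} (s : basis_name) :
    seq (R * seq nat * seq nat) :=
  match s with
  | Ba => [:: (1 / 2, knots 3 2 0 2 0 1, [:: 1; 1; 2; 4; 4]%N);
              (3 / 4, knots 2 2 2 1 1 0, [:: 1; 2; 2; 3; 10]%N);
              (3 / 4, knots 2 2 1 2 1 0, [:: 1; 2; 2; 4; 10]%N)]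
  | Bb => [:: (1 / 2, knots 3 2 0 2 0 1, [:: 1; 1; 2; 4; 4]%N);
              (3 / 4, knots 2 2 1 1 1 1, [:: 1; 2; 3; 4; 10]%N);
              (3 / 4, knots 2 2 1 2 1 0, [:: 1; 2; 2; 4; 10]%N)]
  | Bc => [:: (1 / 2, knots 3 2 0 2 0 1, [:: 1; 1; 2; 4; 4]%N);
              (3 / 4, knots 2 2 0 2 1 1, [:: 1; 2; 4; 4; 10]%N);
              (3 / 4, knots 1 2 1 2 1 1, [:: 1; 2; 4; 5; 10]%N)]
  | Bd => [:: (1, knots 3 2 1 2 0 0, [:: 1; 1; 2; 4; 4]%N);
              (3 / 4, knots 2 2 2 1 1 0, [:: 1; 2; 2; 3; 10]%N);
              (1 / 4, knots 2 2 1 2 1 0, [:: 1; 2; 2; 3; 4]%N)]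
  | Be => [:: (1, knots 3 2 1 2 0 0, [:: 1; 1; 2; 4; 4]%N);
              (3 / 4, knots 2 2 1 1 1 1, [:: 1; 2; 3; 4; 10]%N);
              (1 / 4, knots 2 2 1 2 1 0, [:: 1; 2; 2; 3; 4]%N)]
  | Bf => [:: (1, knots 3 2 1 2 0 0, [:: 1; 1; 2; 4; 4]%N);
              (1 / 4, knots 2 2 0 2 1 1, [:: 1; 2; 3; 4; 4]%N);
              (1 / 2, knots 1 2 1 2 1 1, [:: 1; 2; 3; 4; 8]%N)]
  end.

(* The functions w Q[sigma(K)] with their dual points sigma(P), each listed
   once: sorting makes equal multisets equal sequences. *)
Definition sym_orbit {R : realType} (r : R * seq nat * seq nat) :
    seq (R * seq nat * seq nat) :=
  let: (w, K, P) := r in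
  [seq (w, KP.1, KP.2) | KP <- undup
     [seq (sort leq (map (relabel s) K), sort leq (map (relabel s) P))
        | s <- symmetries]].

Definition basis_data {R : realType} (s : basis_name) :
    seq (R * seq nat * seq nat) :=
  flatten (map sym_orbit (common_reps ++ specific_reps s)).

Lemma size_basis_data {R : realType} (s : basis_name) :
  size (@basis_data R s) = 39%N.
Proof. by case: s. Qed.

Definition basis_elt {R : realType} (s : basis_name) (i : 'I_39) :
    R * seq nat * seq nat :=
  nth (0, [::], [::]) (basis_data s) i.

Definition basis_fun {R : realType} (v : nat -> R * R) (s : basis_name)
    (i : 'I_39) (x : R * R) : R :=
  let: (w, K, _) := basis_elt s i in w * simplex_spline_on v K x.

Definition domain_point {R : realType} (v : nat -> R * R) (s : basis_name)
    (i : 'I_39) : R * R :=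
  let: (_, _, P) := @basis_elt R s i in 5^-1 *: \sum_(j <- P) v j.

Definition spline {R : realType} (v : nat -> R * R) (s : basis_name)
    (c : 'cV[R]_39) (x : R * R) : R :=
  \sum_(i < 39) c i 0 * basis_fun v s i x.

(* Essential supremum over D. *)
Definition Linfty_norm {R : realType} (D : set (R * R)) (f : R * R -> R) :
    \bar R :=
  'N[lebesgue2]_+oo[EFin \o (f \_ D)]%E.

(* On column vectors, `|b| is the library norm, i.e. the maximum norm.  The
   constant K is the same for all triangles. *)
Definition stability_constant {R : realType} (s : basis_name) (K : R) : Prop :=
  0 < K /\
  forall v1 v2 v3 : R * R, nondegenerate_triangle v1 v2 v3 ->
  let v := split12 v1 v2 v3 in
  forall b : 'cV[R]_39,
    ((K^-1 * `|b|)%:E <= Linfty_norm (triangle v) (spline v s b) <= `|b|%:E)%E.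

Definition axis {R : realType} (i : 'I_2) : R * R :=
  if i == 0 then (1, 0) else (0, 1).

Definition hessian {R : realType} (f : R * R -> R) (x : R * R) : 'M[R]_2 :=
  \matrix_(i < 2, j < 2) 'D_(axis i) (fun y => 'D_(axis j) f y) x.

(* The Hessian in the interior of D, extended by continuity to D. *)
Definition hessian_on {R : realType} (D : set (R * R)) (f : R * R -> R)
    (x : R * R) : 'M[R]_2 :=
  lim (hessian f y @[y --> within D° (nbhs x)]).

(* The matrix norm of the library is the largest entry, not this one. *)
Definition row_sum_norm {R : realType} (A : 'M[R]_2) : R :=
  \big[Num.max/0]_(i < 2) \sum_(j < 2) `|A i j|.

(* Main.v *)
From Stdlib Require Import ZArith.
Require Import Defs.
From HB Require Import structures.
From mathcomp Require Import all_boot all_order all_algebra.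
From mathcomp Require Import all_classical all_reals all_analysis.
From mathcomp Require Import ring lra zify ssrZ ess_sup_inf.

Set Implicit Arguments.
Unset Strict Implicit.
Unset Printing Implicit Defensive.

Import Order.TTheory GRing.Theory Num.Theory numFieldNormedType.Exports.

Local Open Scope classical_set_scope.
Local Open Scope ring_scope.

(** Let M be the supremum of the norm of the Hessian and let xi_i be the domain
point of the basis function S_i.  The basis functions sum to 1 and reproduce
affine functions with the domain points as coefficients.  For x in T, the
first-order Taylor polynomial of f at x is therefore reproduced exactly by its
values at the xi_i, and
  sum_i (c_i - f(xi_i)) S_i(x) = - sum_i r_i(x) S_i(x),
where the remainder r_i(x) of f at xi_i satisfies |r_i(x)| <= 2 h^2 M, as both
components of xi_i - x are at most h ([taylor_bound_longest_edge]).  The upper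
stability inequality, applied to the finitely many vectors with entries 1 and -1,
gives sum_i |S_i(x)| <= 1 for almost every x ([ae_sum_normr_basis_fun]).  Hence
the spline with coefficients c_i - f(xi_i) is bounded by 2 h^2 M almost everywhere
on T, and the lower stability inequality gives the theorem.

This uses three facts about the S_i: their sum, the reproduction of affine
functions ([sum_basis_form]) and two continuous derivatives up to the boundary of
T ([smooth_basis_form]).  They concern finitely many polynomials with integer
coefficients.  Indeed, in the coordinates (s, u) of x = v1 + s (v2 - v1) +
u (v3 - v1), a simplex spline with knots among v1, ..., v6 is a polynomial on each
of the twelve triangles that does not depend on T.  The table [split_table]
gives these polynomials for all knot multisets of the bases and for their
sub-multisets of at least three knots.  A computation ([certificate]) verifies
- that the entries satisfy the recursion of simplex splines, for every choice of
  the affine coefficients in it ([simplex_spline_recE]);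
- that the entries of the bases have the form P + sum_l max(l, 0)^4 p_l, with l
  ranging over the six lines of the split, P a polynomial and p_l affine
  ([simplex_splineE]), a form that is continuous on T and of class C^2, and
  which is therefore the extension by continuity ([simplex_spline_onE]);
- that these forms have the required sums ([sum_ev_form]).

The start of the recursion involves areas, which are Lebesgue measures in the
plane.  The area of a nondegenerate triangle is a determinant times the area of
one fixed triangle ([area_hull3]), and this factor cancels in quotients. *)

(** * Lebesgue measure and affine maps of the plane *)

Lemma lebesgue_measure_preimage_itv {R : realType} (d e a b : R) : d != 0 ->
  lebesgue_measure ((fun y : R => d * y + e) @^-1` `]a, b]) =
  (`|d|^-1%:E * lebesgue_measure `]a, b]%classic)%E.
Proof.
move=> d0; have [ba|ab] := leP b a.
  rewrite [in RHS]lebesgue_measure_itv /= lte_fin ltNge ba /= mule0.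
  rewrite (_ : _ @^-1` _ = set0) ?measure0// -subset0 => y /=.
  by rewrite in_itv/= => /andP[h1 h2]; have := lt_le_trans h1 h2; rewrite ltNge ba.
rewrite [in RHS]lebesgue_measure_itv /= lte_fin ab.
have [dp|dn|/eqP] := ltgtP d 0; last by rewrite (negPf d0).
- rewrite (_ : _ @^-1` _ = `[(b - e) / d, (a - e) / d[%classic); last first.
    apply/seteqP; split => y /=; rewrite !in_itv/= !ler_ndivrMr// !ltr_ndivlMr//.
      by move=> /andP[h1 h2]; apply/andP; split; lra.
    by move=> /andP[h1 h2]; apply/andP; split; lra.
  rewrite lebesgue_measure_itv /= lte_fin ltr_nM2r ?invr_lt0//.
  rewrite ltrD2r ab -!EFinD -EFinM ltr0_norm//; congr (_%:E).
  by field.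
- rewrite (_ : _ @^-1` _ = `](a - e) / d, (b - e) / d]%classic); last first.
    apply/seteqP; split => y /=; rewrite !in_itv/= !ler_pdivlMr// !ltr_pdivrMr//.
      by move=> /andP[h1 h2]; apply/andP; split; lra.
    by move=> /andP[h1 h2]; apply/andP; split; lra.
  rewrite lebesgue_measure_itv /= lte_fin ltr_pM2r ?invr_gt0//.
  rewrite ltrD2r ab -!EFinD -EFinM gtr0_norm//; congr (_%:E).
  by field.
Qed.

Lemma measurable_affine_line {R : realType} (d e : R) :
  measurable_fun setT (fun y : R => d * y + e).
Proof. by apply: measurable_realfun.measurable_funD => //; exact: measurable_funM. Qed.

(** Up to the factor, the pushforward of Lebesgue measure agrees with it on
intervals, and Lebesgue measure is determined by these values. *)
Lemma lebesgue_measure_affine {R : realType} (d e : R) (A : set R) : d != 0 ->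
  measurable A ->
  lebesgue_measure ((fun y : R => d * y + e) @^-1` A) =
  (`|d|^-1%:E * lebesgue_measure A)%E.
Proof.
move=> d0 mA.
pose phi (y : measurableTypeR R) : measurableTypeR R := d * y + e.
have mphi : measurable_fun setT phi by exact: measurable_affine_line.
pose mu := mscale (NngNum (normr_ge0 d)) (pushforward lebesgue_measure phi).
rewrite [in RHS](@lebesgue_measure_unique R (mu mphi))//.
  by rewrite /mu /mscale /= muleA -EFinM mulVf ?mul1e// normr_eq0.
move=> _ [[a b]] _ <-.
rewrite [RHS](_ : _ =
    `|d|%:E * @lebesgue_measure R ((fun y : R => (d * y + e)%R) @^-1` `]a, b]))%E//.
by rewrite lebesgue_measure_preimage_itv// muleA -EFinM mulfV ?mul1e// normr_eq0.
Qed.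

(** A dilation, a shear and a translation along one axis of the plane. *)
Definition vshear {R : realType} (d a b : R) (x : R * R) : R * R :=
  (x.1, d * x.2 + (a * x.1 + b)).

Definition hshear {R : realType} (d a b : R) (x : R * R) : R * R :=
  (d * x.1 + (a * x.2 + b), x.2).

Notation plane R := (measurableTypeR R * measurableTypeR R)%type.

(** The product measure integrates vertical sections by definition; horizontal
shears act on the other sections. *)
Lemma lebesgue2_swap {R : realType} (A : set (plane R)) : measurable A ->
  lebesgue2 A = (\int[lebesgue_measure]_y lebesgue_measure (ysection A y))%E.
Proof.
have := @product_measure_unique _ _ _ _ R (@lebesgue_measure R)
  (@lebesgue_measure R) (@lebesgue_measure R \x^ @lebesgue_measure R)%E
  (fun _ _ => @product_measure2E _ _ _ _ _ (@lebesgue_measure R)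
                (@lebesgue_measure R) _ _) A.
exact.
Qed.

Lemma measurable_affine {R : realType} (al be ga : R) :
  measurable_fun [set: plane R] (fun x => al * x.1 + be * x.2 + ga).
Proof.
do 2! [apply: measurable_realfun.measurable_funD => //];
  apply: measurable_realfun.measurable_funM => //.
Qed.

Lemma measurable_hshear {R : realType} (d a b : R) :
  measurable_fun [set: plane R] (hshear d a b : plane R -> plane R).
Proof.
apply: measurable_fun_pair => /=; last exact: measurable_snd.
rewrite (_ : (fun _ => _) = fun x => d * x.1 + a * x.2 + b).
  exact: measurable_affine.
by apply/funext => x; rewrite addrA.
Qed.

Lemma measurable_vshear {R : realType} (d a b : R) :
  measurable_fun [set: plane R] (vshear d a b : plane R -> plane R).
Proof.
apply: measurable_fun_pair => /=; first exact: measurable_fst.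
rewrite (_ : (fun _ => _) = fun x => a * x.1 + d * x.2 + b).
  exact: measurable_affine.
by apply/funext => x; ring.
Qed.

Lemma lebesgue2_vshear {R : realType} (d a b : R) (A : set (plane R)) : d != 0 ->
  measurable A ->
  lebesgue2 (vshear d a b @^-1` A) = (`|d|^-1%:E * lebesgue2 A)%E.
Proof.
move=> d0 mA; rewrite /lebesgue2 /= /product_measure1.
rewrite -ge0_integralZl//; last first.
  exact: measurable_fun_xsection.
apply: eq_integral => x _ /=.
rewrite -(lebesgue_measure_affine (a * x + b) d0); last exact: measurable_xsection.
by rewrite !xsectionE.
Qed.

Lemma lebesgue2_hshear {R : realType} (d a b : R) (A : set (plane R)) : d != 0 ->
  measurable A ->
  lebesgue2 (hshear d a b @^-1` A) = (`|d|^-1%:E * lebesgue2 A)%E.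
Proof.
move=> d0 mA; have mA' : measurable (hshear d a b @^-1` A).
  rewrite -[X in measurable X]setTI; exact: measurable_hshear.
rewrite !lebesgue2_swap//.
rewrite -ge0_integralZl//; last first.
  exact: measurable_fun_ysection.
apply: eq_integral => y _ /=.
rewrite -(lebesgue_measure_affine (a * y + b) d0); last exact: measurable_ysection.
by rewrite !ysectionE.
Qed.

Definition cross {R : realType} (a b : R * R) : R := a.1 * b.2 - a.2 * b.1.

Definition from_coords {R : realType} (p a b x : R * R) : R * R :=
  p + x.1 *: a + x.2 *: b.

Lemma from_coordsE {R : realType} (p a b x : R * R) : from_coords p a b x =
  (p.1 + x.1 * a.1 + x.2 * b.1, p.2 + x.1 * a.2 + x.2 * b.2).
Proof. by []. Qed.

(** Cramer's rule for the inverse of [from_coords p a b]. *)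
Definition coords {R : realType} (p a b x : R * R) : R * R :=
  (cross (x - p) b / cross a b, cross a (x - p) / cross a b).

Definition unit_triangle {R : realType} : set (plane R) :=
  [set x : plane R | [/\ 0 <= x.1, 0 <= x.2 & x.1 + x.2 <= 1]].

Lemma from_coordsK {R : realType} (p a b : R * R) : cross a b != 0 ->
  cancel (from_coords p a b) (coords p a b).
Proof.
move=> + [s t]; rewrite from_coordsE /coords /cross /= => c0.
by apply/pair_equal_spec; split; field.
Qed.

Lemma coordsK {R : realType} (p a b : R * R) : cross a b != 0 ->
  cancel (coords p a b) (from_coords p a b).
Proof.
move=> + [s t]; rewrite from_coordsE /coords /cross /= => c0.
by apply/pair_equal_spec; split; field.
Qed.

Lemma measurable_unit_triangle {R : realType} : measurable (@unit_triangle R).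
Proof.
have H (al be ga : R) :
    measurable [set x : plane R | al * x.1 + be * x.2 + ga >= 0].
  rewrite (_ : [set _ | _] =
     setT `&` (fun x => al * x.1 + be * x.2 + ga) @^-1` `[0, +oo[%classic).
    exact: measurable_affine.
  by rewrite setTI; apply/seteqP; split => x /=; rewrite in_itv/= andbT.
rewrite (_ : unit_triangle = [set x : plane R | 1 * x.1 + 0 * x.2 + 0 >= 0] `&`
    ([set x : plane R | 0 * x.1 + 1 * x.2 + 0 >= 0] `&`
     [set x : plane R | (-1) * x.1 + (-1) * x.2 + 1 >= 0])).
  by apply: measurableI => //; apply: measurableI.
apply/seteqP; split => x /=.
  by move=> [h1 h2 h3]; split; [|split]; lra.
by move=> [h1 [h2 h3]]; split; lra.
Qed.

Lemma measurable_coords {R : realType} (p a b : R * R) :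
  measurable_fun [set: plane R] (coords p a b : plane R -> plane R).
Proof.
apply: measurable_fun_pair => /=.
  rewrite (_ : (fun _ => _) = fun x => b.2 / cross a b * x.1 +
    (- b.1 / cross a b) * x.2 + (- cross p b / cross a b)).
    exact: measurable_affine.
  by apply/funext => x; rewrite /cross /=; ring.
rewrite (_ : (fun _ => _) = fun x => - a.2 / cross a b * x.1 +
  (a.1 / cross a b) * x.2 + (- cross a p / cross a b)).
  exact: measurable_affine.
by apply/funext => x; rewrite /cross /=; ring.
Qed.

(** As the first component of [a] is nonzero, the map is a composite of a
horizontal and a vertical shear. *)
Lemma lebesgue2_from_coords {R : realType} (p a b : R * R) (A : set (plane R)) :
  a.1 != 0 -> cross a b != 0 -> measurable A ->
  lebesgue2 (from_coords p a b @^-1` A) = (`|cross a b|^-1%:E * lebesgue2 A)%E.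
Proof.
move=> a0 c0 mA.
have a1 : cross a b / a.1 != 0 by rewrite mulf_neq0// invr_eq0.
pose g := vshear (cross a b / a.1) (a.2 / a.1) (p.2 - a.2 / a.1 * p.1).
rewrite (_ : from_coords p a b = g \o hshear a.1 b.1 p.1); last first.
  apply/funext => x /=.
  rewrite from_coordsE /g /vshear /hshear /cross /=.
  by apply/pair_equal_spec; split; [ring|field].
rewrite comp_preimage; have mg : measurable (g @^-1` A).
  rewrite -[X in measurable X]setTI; exact: measurable_vshear.
rewrite lebesgue2_hshear// lebesgue2_vshear// muleA -EFinM normrM normfV.
by congr (_%:E * _)%E; field; rewrite !normr_eq0 a0 c0.
Qed.

(** Only quotients of areas occur below; this factor cancels in them because it
is positive and finite. *)
Lemma lebesgue2_unit_triangle {R : realType} :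
  (0 < @lebesgue2 R unit_triangle < +oo)%E.
Proof.
have itv1 (u : R) : 0 <= u -> lebesgue_measure (`[0, u]%classic : set R) = u%:E.
  move=> u0; rewrite lebesgue_measure_itv /= lte_fin -EFinD subr0.
  by move: u0; rewrite le_eqVlt => /predU1P[<-|->//]; rewrite ltxx.
have sq (u : R) : 0 <= u -> @lebesgue2 R (`[0, u] `*` `[0, u]) = (u * u)%:E.
  move=> u0; rewrite /lebesgue2 product_measure1E//.
  by rewrite EFinM; congr (_ * _)%E; exact: itv1.
apply/andP; split.
- apply: (@lt_le_trans _ _ (lebesgue2 (`[0, 2^-1 : R] `*` `[0, 2^-1 : R]))).
    by rewrite sq ?lte_fin ?invr_ge0 ?mulr_gt0 ?invr_gt0.
  apply: le_measure; rewrite ?inE; [exact: measurableX|exact: measurable_unit_triangle|].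
  by move=> x [] /=; rewrite !in_itv/= => /andP[? ?] /andP[? ?]; split; lra.
- apply: (@le_lt_trans _ _ (lebesgue2 (`[0, 1 : R] `*` `[0, 1 : R]))).
    apply: le_measure; rewrite ?inE; [exact: measurable_unit_triangle|exact: measurableX|].
    by move=> x [h1 h2 h3]; split => /=; rewrite in_itv/=; apply/andP; split; lra.
  by rewrite sq ?ltry.
Qed.

(** * Triangles and convex sets *)

Definition triangle_at {R : realType} (p a b : R * R) : set (plane R) :=
  [set from_coords p a b y | y in unit_triangle].

Lemma triangle_atP {R : realType} (p a b x : R * R) : cross a b != 0 ->
  triangle_at p a b x <-> unit_triangle (coords p a b x).
Proof.
move=> c0; split; first by move=> [y Ty <-]; rewrite from_coordsK.
by exists (coords p a b x); rewrite ?coordsK.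
Qed.

Lemma measurable_triangle_at {R : realType} (p a b : R * R) : cross a b != 0 ->
  measurable (triangle_at p a b).
Proof.
move=> c0; rewrite (_ : triangle_at p a b = setT `&` coords p a b @^-1` unit_triangle).
  by apply: measurable_coords => //; exact: measurable_unit_triangle.
by rewrite setTI; apply/seteqP; split => x; move/(triangle_atP _ _ c0).
Qed.

Lemma triangle_atC {R : realType} (p a b : R * R) :
  triangle_at p a b = triangle_at p b a.
Proof.
suff H a' b' : triangle_at p a' b' `<=` triangle_at p b' a'.
  by apply/seteqP; split; exact: H.
move=> _ [[s t] [/= s0 t0 st1] <-]; exists (t, s); first by split => //=; rewrite addrC.
by rewrite /from_coords /= addrAC.
Qed.

(** One of [a] and [b] has a nonzero first component, and exchanging them
exchanges the two coordinates of the unit triangle. *)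
Lemma lebesgue2_triangle_at {R : realType} (p a b : R * R) : cross a b != 0 ->
  lebesgue2 (triangle_at p a b) = (`|cross a b|%:E * lebesgue2 unit_triangle)%E.
Proof.
wlog a0 : a b / a.1 != 0.
  move=> wl c0; have [a0|] := eqVneq a.1 0; last by move/wl; apply.
  rewrite triangle_atC; have cC : cross a b = - cross b a by rewrite /cross; ring.
  rewrite cC normrN; apply: wl; last by rewrite -oppr_eq0 -cC.
  by apply: contraNneq c0 => b0; rewrite /cross a0 b0 !(mul0r, mulr0) subrr.
move=> c0; have mT := measurable_triangle_at p c0.
have := lebesgue2_from_coords p a0 c0 mT.
rewrite (_ : _ @^-1` _ = unit_triangle).
  by move=> ->; rewrite muleA -EFinM mulfV ?mul1e// normr_eq0.
apply/seteqP; split => x /=.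
  by move/(triangle_atP _ _ c0); rewrite from_coordsK.
by move=> Tx; exists x.
Qed.

Definition convex_plane_set {R : realType} (A : set (R * R)) : Prop :=
  forall x y t, A x -> A y -> 0 <= t <= 1 -> A (x + t *: (y - x)).

(** The sections of a convex set are intervals. *)
Lemma measurable_xsection_convex {R : realType} (A : set (plane R)) (u : R) :
  convex_plane_set A -> measurable (xsection A u).
Proof.
move=> cA; apply: measurable_realfun.is_interval_measurable => y z.
rewrite !xsectionE /= => Ay Az w.
move=> /andP[yw wz]; have [yz|zy] := ltP y z; last first.
  by have -> : w = y by apply/le_anti/andP; split => //; exact: le_trans zy.
have := cA _ _ ((w - y) / (z - y)) Ay Az.
rewrite divr_ge0 ?subr_ge0 ?(ltW yz)// ler_pdivrMr ?subr_gt0// mul1r lerB//.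
move=> /(_ isT); congr A; apply/pair_equal_spec.
by split; rewrite /= /GRing.scale /=; field; rewrite subr_eq0 gt_eqF.
Qed.

(** The product measure integrates the measures of sections, so that measurable
sections suffice for monotonicity.  This makes it possible to compare convex
hulls with triangles without discussing their measurability. *)
Lemma le_lebesgue2 {R : realType} (A B : set (plane R)) : A `<=` B ->
  (forall u, measurable (xsection A u)) -> (forall u, measurable (xsection B u)) ->
  (lebesgue2 A <= lebesgue2 B)%E.
Proof.
move=> AB mA mB; rewrite /lebesgue2 /= /product_measure1 !ge0_integralTE//.
apply: ereal_sup_le => _ [g gA <-]; exists g => // u.
apply: le_trans (gA u) _ => /=; apply: le_measure; rewrite ?inE//.
exact: le_xsection.
Qed.

(** * Areas of convex hulls *)

Lemma sum_fst {R : realType} (I : Type) (r : seq I) (F : I -> R * R) :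
  (\sum_(i <- r) F i).1 = \sum_(i <- r) (F i).1.
Proof. exact: (big_morph fst (fun _ _ => erefl) erefl). Qed.

Lemma sum_snd {R : realType} (I : Type) (r : seq I) (F : I -> R * R) :
  (\sum_(i <- r) F i).2 = \sum_(i <- r) (F i).2.
Proof. exact: (big_morph snd (fun _ _ => erefl) erefl). Qed.

Definition affine_fun {R : realType} (al be ga : R) (x : R * R) : R :=
  al * x.1 + be * x.2 + ga.

Lemma affine_fun_comb {R : realType} (al be ga : R) (I : Type) (r : seq I)
    (a : I -> R) (v : I -> R * R) : \sum_(j <- r) a j = 1 ->
  affine_fun al be ga (\sum_(j <- r) a j *: v j) =
  \sum_(j <- r) a j * affine_fun al be ga (v j).
Proof.
move=> a1; rewrite /affine_fun sum_fst sum_snd -[X in _ + _ + X]mulr1 -a1.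
rewrite !mulr_sumr -!big_split /=; apply: eq_bigr => j _.
by rewrite /GRing.scale /=; ring.
Qed.

Lemma hull_affine_ge0 {R : realType} (v : nat -> R * R) (K : seq nat)
    (al be ga : R) (x : R * R) : hull v K x ->
  (forall j, j \in K -> 0 <= affine_fun al be ga (v j)) ->
  0 <= affine_fun al be ga x.
Proof.
move=> [a [a0 a1 <-]] H; rewrite affine_fun_comb// big_seq sumr_ge0// => j.
by rewrite mem_undup => /H; exact: mulr_ge0.
Qed.

Lemma hull_affine_eq0 {R : realType} (v : nat -> R * R) (K : seq nat)
    (al be ga : R) (x : R * R) : hull v K x ->
  (forall j, j \in K -> affine_fun al be ga (v j) = 0) ->
  affine_fun al be ga x = 0.
Proof.
move=> [a [a0 a1 <-]] H; rewrite affine_fun_comb// big_seq big1// => j.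
by rewrite mem_undup => /H ->; rewrite mulr0.
Qed.

Lemma hull_vertex {R : realType} (v : nat -> R * R) (K : seq nat) (i : nat) :
  i \in K -> hull v K (v i).
Proof.
move=> iK; exists (fun j => (j == i)%:R); split => //.
  rewrite (bigD1_seq i) ?mem_undup ?undup_uniq//= eqxx big1 ?addr0//.
  by move=> j /negPf ->.
rewrite (bigD1_seq i) ?mem_undup ?undup_uniq//= eqxx scale1r big1 ?addr0//.
by move=> j /negPf ->; rewrite scale0r.
Qed.

Lemma hull_convex {R : realType} (v : nat -> R * R) (K : seq nat) :
  convex_plane_set (hull v K).
Proof.
move=> _ _ t [a [a0 a1 <-]] [b [b0 b1 <-]] /andP[t0 t1].
exists (fun j => (1 - t) * a j + t * b j); split.
- by move=> j; rewrite addr_ge0// mulr_ge0// subr_ge0.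
- by rewrite big_split /= -!mulr_sumr a1 b1; ring.
- rewrite -sumrB scaler_sumr -big_split /=; apply: eq_bigr => j _.
  by rewrite scalerBr !scalerA -scalerBl -scalerDl; congr (_ *: _); ring.
Qed.

Lemma triangle_at_sub_convex {R : realType} (A : set (R * R)) (p a b : R * R) :
  convex_plane_set A -> A p -> A (p + a) -> A (p + b) -> triangle_at p a b `<=` A.
Proof.
move=> cA Ap Aa Ab _ [[s t] [/= s0 t0 st1] <-].
have [st0|st0] := eqVneq (s + t) 0.
  have [-> ->] : s = 0 /\ t = 0 by split; lra.
  by rewrite /from_coords /= !scale0r !addr0.
have stp : 0 < s + t by rewrite lt0r st0 addr_ge0.
have := cA _ _ (t / (s + t)) Aa Ab.
rewrite divr_ge0 ?addr_ge0// ler_pdivrMr// mul1r lerDr s0 => /(_ isT) Aq.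
have := cA _ _ (s + t) Ap Aq; rewrite addr_ge0// st1 => /(_ isT).
congr A; rewrite from_coordsE.
by apply/pair_equal_spec; split; rewrite /= /GRing.scale /=; field.
Qed.

Lemma lebesgue2_line {R : realType} (al be ga : R) :
  (al != 0) || (be != 0) ->
  @lebesgue2 R [set x | affine_fun al be ga x = 0] = 0%E.
Proof.
have set1' (A : set R) (y : R) : A `<=` [set y] -> lebesgue_measure A = 0%E.
  move=> /subset_set1[->|->]; first exact: measure0.
  exact: lebesgue_measure_set1.
case: (eqVneq be 0) => [->|be0 _].
  rewrite orbF => al0.
  rewrite lebesgue2_swap; last first.
    rewrite -[X in measurable X]setTI.
    exact: (measurable_affine al 0 ga measurableT (measurable_set1 0)).
  apply: integral0_eq => y _; apply: (set1' _ (- ga / al)) => x.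
  rewrite ysectionE /= /affine_fun /= => h.
  by apply: (mulfI al0); rewrite mulrCA mulfV// mulr1; lra.
rewrite /lebesgue2 /= /product_measure1.
apply: integral0_eq => x _; apply: (set1' _ ((- ga - al * x) / be)) => y.
rewrite xsectionE /= /affine_fun /= => h.
by apply: (mulfI be0); rewrite mulrCA mulfV// mulr1; lra.
Qed.

Lemma lebesgue2_sub_line {R : realType} (al be ga : R) (A : set (R * R)) :
  (al != 0) || (be != 0) -> convex_plane_set A ->
  (forall x, A x -> affine_fun al be ga x = 0) -> @lebesgue2 R A = 0%E.
Proof.
move=> ab cA AL; apply/eqP; rewrite eq_le; apply/andP; split; last first.
  by apply: integral_ge0 => *; exact: measure_ge0.
rewrite -(lebesgue2_line ga ab); apply: le_lebesgue2 => //.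
  by move=> u; exact: measurable_xsection_convex.
move=> u; apply: measurable_xsection_convex => x y t /= Lx Ly _.
rewrite /affine_fun /=; move: Lx Ly; rewrite /affine_fun /GRing.scale /= => Lx Ly.
transitivity ((1 - t) * (al * x.1 + be * x.2 + ga) +
  t * (al * y.1 + be * y.2 + ga)); first by ring.
by rewrite Lx Ly !mulr0 addr0.
Qed.

Lemma hull3 {R : realType} (v : nat -> R * R) (i j k : nat) :
  uniq [:: i; j; k] ->
  hull v [:: i; j; k] = triangle_at (v i) (v j - v i) (v k - v i).
Proof.
move=> U; apply/seteqP; split.
- move=> x [a [a0]]; rewrite undup_id// !big_cons !big_nil !addr0 => a1 <-.
  exists (a j, a k); first by split => //=; have := a0 i; lra.
  rewrite from_coordsE; apply/pair_equal_spec; split;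
    rewrite /= /GRing.scale /= (_ : a i = 1 - a j - a k); by [ring|lra].
- apply: triangle_at_sub_convex; first exact: hull_convex.
  + by apply: hull_vertex; rewrite !inE eqxx.
  + by rewrite addrC subrK; apply: hull_vertex; rewrite !inE eqxx orbT.
  + by rewrite addrC subrK; apply: hull_vertex; rewrite !inE eqxx !orbT.
Qed.

Lemma area_hull3 {R : realType} (v : nat -> R * R) (i j k : nat) :
  let c := cross (v j - v i) (v k - v i) in c != 0 ->
  area (hull v [:: i; j; k]) = `|c| * fine (@lebesgue2 R unit_triangle).
Proof.
move=> c c0; have U : uniq [:: i; j; k].
  rewrite /= !inE !andbT negb_or -andbA; apply/and3P.
  split; apply: contraNneq c0 => ij; apply/eqP; rewrite /c ij /cross /=; by ring.
rewrite hull3// /area lebesgue2_triangle_at// fineM//.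
have /andP[m0 moo] := @lebesgue2_unit_triangle R.
by rewrite fin_numElt moo andbT (lt_trans _ m0).
Qed.

(** The hull lies on a line: the one through two distinct knots, or any line
through the only knot. *)
Lemma area_hull_collinear {R : realType} (v : nat -> R * R) (K : seq nat) :
  (forall i j k, i \in K -> j \in K -> k \in K ->
     cross (v j - v i) (v k - v i) = 0) -> area (hull v K) = 0.
Proof.
move=> H; rewrite /area; suff -> : lebesgue2 (hull v K) = 0%E by [].
case: (pselect (exists i j, [/\ i \in K, j \in K & v i != v j])) => [|same].
  move=> [i [j [iK jK ij]]].
  pose al := - (v j - v i).2; pose be := (v j - v i).1.
  apply: (@lebesgue2_sub_line R al be (- (al * (v i).1 + be * (v i).2))).
  - rewrite /al /be; apply: contraNT ij; rewrite negb_or !negbK oppr_eq0 /= !subr_eq0.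
    by move=> /andP[/eqP h2 /eqP h1]; apply/eqP; case: (v i) (v j) h2 h1 => ? ? [? ?] /= -> ->.
  - exact: hull_convex.
  - move=> x hx; apply: (hull_affine_eq0 hx) => k kK.
    by have := H i j k iK jK kK; rewrite /cross /affine_fun /al /be /= => h; lra.
case: (K =P [::]) => [->|/eqP].
  suff -> : hull v [::] = set0 by exact: measure0.
  by rewrite -subset0 => x [a [_]]; rewrite big_nil => /eqP; rewrite eq_sym oner_eq0.
rewrite -size_eq0 -lt0n -has_predT => /hasP[i iK _].
apply: (@lebesgue2_sub_line R 1 0 (- (v i).1)); rewrite ?oner_eq0//.
  exact: hull_convex.
move=> x hx; apply: (hull_affine_eq0 hx) => k kK; rewrite /affine_fun.
have -> : v k = v i.
  by apply: contrapT => /eqP ki; apply: same; exists k, i.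
by ring.
Qed.

(** The hull contains a nondegenerate triangle and is contained in another one.
The upper bound matters since [area] is the real part [fine] of the measure, which
is 0 for sets of infinite measure. *)
Lemma area_hull_neq0 {R : realType} (v : nat -> R * R) (K : seq nat)
    (p a b : R * R) (i j k : nat) : cross a b != 0 ->
  (forall l, l \in K -> triangle_at p a b (v l)) ->
  i \in K -> j \in K -> k \in K -> cross (v j - v i) (v k - v i) != 0 ->
  area (hull v K) != 0.
Proof.
move=> c0 KT iK jK kK ijk; rewrite /area.
have /andP[m0 moo] := @lebesgue2_unit_triangle R.
have gt0 (c : R) : c != 0 -> (0 < `|c|%:E * @lebesgue2 R unit_triangle)%E.
  by move=> cn0; rewrite mule_gt0// lte_fin normr_gt0.
have mH u : measurable (xsection (hull v K : set (plane R)) u).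
  by apply: measurable_xsection_convex; exact: hull_convex.
rewrite gt_eqF// fine_gt0//; apply/andP; split.
  rewrite (lt_le_trans (gt0 _ ijk))// -(lebesgue2_triangle_at (v i) ijk).
  apply: le_lebesgue2 => //; last first.
    by move=> u; apply: measurable_xsection; exact: measurable_triangle_at.
  apply: triangle_at_sub_convex; rewrite ?[_ + (_ - _)]addrC ?subrK;
    by [exact: hull_convex|exact: hull_vertex].
apply: (@le_lt_trans _ _ (lebesgue2 (triangle_at p a b))); last first.
  rewrite lebesgue2_triangle_at// lte_mul_pinfty//; by rewrite ?lee_fin.
apply: le_lebesgue2 => //; last first.
  by move=> u; apply: measurable_xsection; exact: measurable_triangle_at.
move=> x hx; apply/(triangle_atP _ _ c0).
have KT' l : l \in K -> unit_triangle (coords p a b (v l)).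
  by move=> /KT /(triangle_atP _ _ c0).
have E1 y : (coords p a b y).1 = affine_fun (b.2 / cross a b) (- b.1 / cross a b)
    (- cross p b / cross a b) y.
  by rewrite /coords /affine_fun /cross /=; ring.
have E2 y : (coords p a b y).2 = affine_fun (- a.2 / cross a b) (a.1 / cross a b)
    (- cross a p / cross a b) y.
  by rewrite /coords /affine_fun /cross /=; ring.
split.
- by rewrite E1; apply: (hull_affine_ge0 hx) => l /KT' []; rewrite E1.
- by rewrite E2; apply: (hull_affine_ge0 hx) => l /KT' []; rewrite E2.
- rewrite E1 E2 -subr_ge0.
  set l1 := b.2 / _; set l2 := - b.1 / _; set l3 := - cross p b / _.
  set k1 := - a.2 / _; set k2 := a.1 / _; set k3 := - cross a p / _.
  have E : forall y, 1 - (affine_fun l1 l2 l3 y + affine_fun k1 k2 k3 y) =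
      affine_fun (- l1 - k1) (- l2 - k2) (1 - l3 - k3) y.
    by move=> y; rewrite /affine_fun; ring.
  rewrite E; apply: (hull_affine_ge0 hx) => l /KT' [_ _].
  by rewrite E1 E2 -subr_ge0 E.
Qed.

(** * Piecewise polynomials with integer coefficients *)

Section Tables.
Local Open Scope Z_scope.

(** Either a multiple of the barycentric coordinates of a point, or the three
coefficients of a line in these coordinates. *)
Definition vec := (Z * Z * Z)%type.

(** The common denominator of the barycentric coordinates of the ten vertices
is 12. *)
Definition bary12 (j : nat) : vec :=
  nth (0, 0, 0) [:: (0, 0, 0); (12, 0, 0); (0, 12, 0); (0, 0, 12);
    (6, 6, 0); (0, 6, 6); (6, 0, 6); (6, 3, 3); (3, 6, 3); (3, 3, 6);
    (4, 4, 4)] j.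

Definition dot (x y : vec) : Z :=
  let: (x1, x2, x3) := x in let: (y1, y2, y3) := y in
  x1 * y1 + x2 * y2 + x3 * y3.

Definition scalev (c : Z) (x : vec) : vec :=
  let: (x1, x2, x3) := x in (c * x1, c * x2, c * x3).

Definition line_through (x y : vec) : vec :=
  let: (x1, x2, x3) := x in let: (y1, y2, y3) := y in
  (x2 * y3 - x3 * y2, x3 * y1 - x1 * y3, x1 * y2 - x2 * y1).

Definition knot_line (j k : nat) : vec := line_through (bary12 j) (bary12 k).

(** Proportional to the signed area of the triangle of three knots, see
[cross_split12]. *)
Definition knot_det (i j k : nat) : Z := dot (knot_line j k) (bary12 i).

(** In this order the lines v1 v5, v2 v6, v3 v4, v4 v6, v4 v5 and v5 v6. *)
Definition inner_lines : seq vec :=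
  [:: (0, -1, 1); (-1, 0, 1); (-1, 1, 0); (-1, 1, 1); (-1, 1, -1); (-1, -1, 1)].

Definition split_lines : seq vec :=
  [:: (1, 0, 0); (0, 1, 0); (0, 0, 1)] ++ inner_lines.

(** One interior point for each of the twelve triangles, given by 9 times its
barycentric coordinates.  A triangle is recognized by the signs of the split
lines at this point. *)
Definition cells : seq vec :=
  [:: (6, 2, 1); (6, 1, 2); (2, 6, 1); (1, 6, 2); (2, 1, 6); (1, 2, 6);
      (4, 3, 2); (4, 2, 3); (3, 4, 2); (2, 4, 3); (3, 2, 4); (2, 3, 4)].

(** A polynomial in the barycentric coordinates (1 - s - u, s, u) of a point: the
entry of index i lists the coefficients of s^i by increasing powers of u. *)
Definition poly2 := seq (seq Z).

Fixpoint zip_add (A : Type) (add : A -> A -> A) (s t : seq A) : seq A :=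
  match s, t with
  | [::], _ => t
  | _, [::] => s
  | x :: s', y :: t' => add x y :: zip_add add s' t'
  end.

Definition add2 : poly2 -> poly2 -> poly2 := zip_add (zip_add Z.add).
Definition scale2 (c : Z) : poly2 -> poly2 := map (map (Z.mul c)).

Definition mul_line (l : vec) (p : poly2) : poly2 :=
  let: (l1, l2, l3) := l in
  add2 (scale2 l1 p)
    (add2 ([::] :: scale2 (l2 - l1) p) (map (cons 0) (scale2 (l3 - l1) p))).

(** One polynomial for each of [cells]. *)
Definition pieces := seq poly2.

Definition add_pieces : pieces -> pieces -> pieces := zip_add add2.
Definition scale_pieces (c : Z) : pieces -> pieces := map (scale2 c).
Definition eq_pieces (P Q : pieces) : bool :=
  all (all (all (Z.eqb 0))) (add_pieces P (scale_pieces (-1) Q)).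
Definition mul_line_pieces (l : vec) : pieces -> pieces := map (mul_line l).

Definition table := seq (seq nat * pieces).

Fixpoint lookup (t : table) (K : seq nat) : option pieces :=
  if t is (K', P) :: t' then if K' == K then Some P else lookup t' K else None.

Definition noncollinear (b : nat * nat * nat) : bool :=
  ~~ (knot_det b.1.1 b.1.2 b.2 =? 0).

Definition triples (K : seq nat) : seq (nat * nat * nat) :=
  [seq (ij, k) | ij <- [seq (i, j) | i <- undup K, j <- undup K], k <- undup K].

(** Three knots that can carry the affine coefficients of the recursion. *)
Definition base (K : seq nat) : option (nat * nat * nat) :=
  ohead [seq b <- triples K | noncollinear b].

(** Decides whether the cell of [c] lies in the triangle of three knots.  One
point of the cell is enough, because no line through two of v1, ..., v6 cuts a
cell. *)
Definition inside (i j k : nat) (c : vec) : bool :=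
  let d := knot_det i j k in
  [&& 0 <? d * dot (knot_line j k) c, 0 <? d * dot (knot_line k i) c &
      0 <? d * dot (knot_line i j) c].

(** Cramer's rule without the denominator: the coefficient of a knot is the line
through the other two, which acts on pieces by [F]. *)
Definition cramer (F : vec -> pieces -> pieces) (b : nat * nat * nat)
    (S : pieces * pieces * pieces) : pieces :=
  let: (i, j, k) := b in let: (Pi, Pj, Pk) := S in
  add_pieces (F (knot_line j k) Pi)
    (add_pieces (F (knot_line k i) Pj) (F (knot_line i j) Pk)).

Definition subpieces (t : table) (K : seq nat) (b : nat * nat * nat) :=
  let sub l := odflt [::] (lookup t (rem l K)) in
  (sub b.1.1, sub b.1.2, sub b.2).

Definition indicator_pieces (m : Z) (b : nat * nat * nat) : pieces :=
  let: (i, j, k) := b in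
  [seq if inside i j k c then [:: [:: m]] else [::] | c <- cells].

(** One step of the recursion.  The divisions are meant to be exact, which
[entry_ok] verifies on the result. *)
Definition spline_pieces (t : table) (K : seq nat) : pieces :=
  if base K is Some b then
    let d := knot_det b.1.1 b.1.2 b.2 in
    if size K == 3%N then indicator_pieces (Z.div 1728 (Z.abs d)) b
    else
      let div_d (l : vec) := let: (l1, l2, l3) := scalev 12 l in
                             (Z.div l1 d, Z.div l2 d, Z.div l3 d) in
      cramer (fun l => mul_line_pieces (div_d l)) b (subpieces t K b)
  else [::].

Fixpoint levels (n : nat) (Ks : seq (seq nat)) : table :=
  if n is n'.+1 then
    let t := levels n' (undup [seq rem j K | K <- Ks, j <- undup K]) in
    [seq (K, spline_pieces t K) | K <- Ks] ++ t
  else [seq (K, spline_pieces [::] K) | K <- Ks].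

(** The recursion, multiplied by a determinant d to stay within the integers.
The value must not depend on the affine coefficients beta_l with
x = sum_l beta_l v_l.  For more than three knots, the first test is the recursion
for the coefficients that are carried by [base K].  The second one expresses the
spline of K without v_l by the three splines that occur in the first test, with
the barycentric coordinates of v_l as coefficients; weighted with arbitrary beta_l
and summed over l, these identities give back the combination of the first test.
The number 1728 is the cube of the denominator 12 in [bary12]. *)
Definition entry_ok (t : table) (KP : seq nat * pieces) : bool :=
  let: (K, P) := KP in
  all (fun j => 0 < j <= 6)%N K &&
  if base K is Some b then
    let d := knot_det b.1.1 b.1.2 b.2 in
    if size K == 3%N then
      (K == [:: b.1.1; b.1.2; b.2]) &&
      eq_pieces (scale_pieces (Z.abs d) P) (indicator_pieces 1728 b)
    else
      let S := subpieces t K b in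
      eq_pieces (scale_pieces d P) (cramer (fun l => mul_line_pieces (scalev 12 l)) b S) &&
      all (fun l => if lookup t (rem l K) is Some Q then
             eq_pieces (scale_pieces d Q)
               (cramer (fun L => scale_pieces (dot L (bary12 l))) b S)
           else false) (undup K)
  else P == [::].

(** The representatives of the bases with their weights multiplied by 4, so that
all data are integers. *)
Definition quarter_reps (s : basis_name) : seq (Z * seq nat * seq nat) :=
  [:: (1, knots 6 0 0 1 0 1, [:: 1; 1; 1; 1; 1]%N);
      (1, knots 5 0 0 2 0 1, [:: 1; 1; 1; 1; 4]%N);
      (2, knots 4 1 0 2 0 1, [:: 1; 1; 1; 4; 4]%N);
      (4, knots 1 4 1 1 1 0, [:: 2; 2; 2; 4; 5]%N);
      (2, knots 1 3 1 2 1 0, [:: 1; 2; 2; 4; 5]%N)] ++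
  match s with
  | Ba => [:: (2, knots 3 2 0 2 0 1, [:: 1; 1; 2; 4; 4]%N);
              (3, knots 2 2 2 1 1 0, [:: 1; 2; 2; 3; 10]%N);
              (3, knots 2 2 1 2 1 0, [:: 1; 2; 2; 4; 10]%N)]
  | Bb => [:: (2, knots 3 2 0 2 0 1, [:: 1; 1; 2; 4; 4]%N);
              (3, knots 2 2 1 1 1 1, [:: 1; 2; 3; 4; 10]%N);
              (3, knots 2 2 1 2 1 0, [:: 1; 2; 2; 4; 10]%N)]
  | Bc => [:: (2, knots 3 2 0 2 0 1, [:: 1; 1; 2; 4; 4]%N);
              (3, knots 2 2 0 2 1 1, [:: 1; 2; 4; 4; 10]%N);
              (3, knots 1 2 1 2 1 1, [:: 1; 2; 4; 5; 10]%N)]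
  | Bd => [:: (4, knots 3 2 1 2 0 0, [:: 1; 1; 2; 4; 4]%N);
              (3, knots 2 2 2 1 1 0, [:: 1; 2; 2; 3; 10]%N);
              (1, knots 2 2 1 2 1 0, [:: 1; 2; 2; 3; 4]%N)]
  | Be => [:: (4, knots 3 2 1 2 0 0, [:: 1; 1; 2; 4; 4]%N);
              (3, knots 2 2 1 1 1 1, [:: 1; 2; 3; 4; 10]%N);
              (1, knots 2 2 1 2 1 0, [:: 1; 2; 2; 3; 4]%N)]
  | Bf => [:: (4, knots 3 2 1 2 0 0, [:: 1; 1; 2; 4; 4]%N);
              (1, knots 2 2 0 2 1 1, [:: 1; 2; 3; 4; 4]%N);
              (2, knots 1 2 1 2 1 1, [:: 1; 2; 3; 4; 8]%N)]
  end.

Definition quarter_orbit (r : Z * seq nat * seq nat) : seq (Z * seq nat * seq nat) :=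
  let: (w, K, P) := r in
  [seq (w, KP.1, KP.2) | KP <- undup
     [seq (sort leq (map (relabel s) K), sort leq (map (relabel s) P))
        | s <- symmetries]].

Definition quarter_data (s : basis_name) := flatten (map quarter_orbit (quarter_reps s)).

Definition top_knots : seq (seq nat) :=
  undup (flatten [seq map (fun r => r.1.2) (quarter_data s)
                 | s <- [:: Ba; Bb; Bc; Bd; Be; Bf]]).

Definition coef2 (p : poly2) (i j : nat) : Z := nth 0 (nth [::] p i) j.

(** The affine quotient of p by l^4, read off from three coefficients of p.  The
first coefficient of an inner line is -1, or 0 for the line v1 v5; [form_ok]
checks the result. *)
Definition quotient4 (l : vec) (p : poly2) : poly2 :=
  let: (l1, l2, l3) := l in
  let: (c, cs, ct) :=
    if l1 =? 0 then
      (coef2 p 4 0, coef2 p 5 0, coef2 p 4 1 + 4 * coef2 p 5 0)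
    else
      let c := coef2 p 0 0 in
      (c, coef2 p 1 0 - 4 * (l2 - l1) * l1 * c,
       coef2 p 0 1 - 4 * (l3 - l1) * l1 * c) in
  [:: [:: c; ct]; [:: cs]].

(** For each inner line, two cells on its two sides that no other inner line
separates. *)
Definition jumps : seq (nat * nat) := [:: (0, 1); (8, 9); (6, 8); (0, 6); (8, 2); (10, 4)]%N.

(** Writes a piecewise polynomial as P_0 + sum_l max(l, 0)^4 p_l.  All inner lines
are negative on the first cell, hence P_0 is the polynomial of that cell.  When
the line l is crossed, only the term of l changes, hence p_l is determined by one
jump. *)
Definition cross_form (P : pieces) : seq poly2 :=
  nth [::] P 0 ::
  [seq quotient4 ll.1
     (add2 (nth [::] P ll.2.2) (scale2 (-1) (nth [::] P ll.2.1)))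
  | ll <- zip inner_lines jumps].

Definition on_cell (F : seq poly2) (c : vec) : poly2 :=
  foldr (fun lp q => if 0 <? dot lp.1 c then
           add2 (iter 4 (mul_line lp.1) lp.2) q else q)
    (nth [::] F 0) (zip inner_lines (behead F)).

Definition form_ok (P : pieces) : bool :=
  eq_pieces P [seq on_cell (cross_form P) c | c <- cells].

Definition weighted_sum (t : table) (f : seq nat -> Z)
    (D : seq (Z * seq nat * seq nat)) : seq poly2 :=
  foldr (fun r q => let: (w, K, P) := r in
          add_pieces (scale_pieces (w * f P) (cross_form (odflt [::] (lookup t K)))) q) [::] D.

(** Twelve times the coordinate s (for n = 0) or u (for n = 1) of a sum of
vertices. *)
Definition coord12 (n : nat) (P : seq nat) : Z :=
  foldr (fun j z => let: (x, y, z') := bary12 j in (if n is 0%N then y else z') + z) 0 P.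

(** The weights are in quarters and a domain point is an average of five points
with denominator 12, which explains 4 and 240 = 4 * 5 * 12. *)
Definition sums_ok (t : table) (s : basis_name) : bool :=
  [&& eq_pieces (weighted_sum t (fun=> 1) (quarter_data s)) [:: [:: [:: 4]]],
      eq_pieces (weighted_sum t (coord12 0) (quarter_data s)) [:: [:: [::]; [:: 240]]] &
      eq_pieces (weighted_sum t (coord12 1) (quarter_data s)) [:: [:: [:: 0; 240]]]].

Definition split_table : table := levels 5 top_knots.

Definition knot_line_ok (j k : nat) : bool :=
  has (fun l => let m := Z.div (dot (knot_line j k) l) (dot l l) in
     ~~ (m =? 0) && (knot_line j k == scalev m l)) split_lines.

Definition certificate (t : table) : bool :=
  [&& all (entry_ok t) t,
      all (fun K => if lookup t K is Some P then (size K == 8%N) && form_ok P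
                    else false) top_knots &
      all (sums_ok t) [:: Ba; Bb; Bc; Bd; Be; Bf]].

End Tables.

(** * Evaluation of piecewise polynomials *)

Section Evaluation.
Context {R : realType}.
Implicit Types (s t : R).

Definition zr (z : Z) : R := (int_of_Z z)%:~R.

Lemma zrD x y : zr (Z.add x y) = zr x + zr y.
Proof. by rewrite /zr -intrD -rmorphD. Qed.

Lemma zrM x y : zr (Z.mul x y) = zr x * zr y.
Proof. by rewrite /zr -intrM -rmorphM. Qed.

Lemma zrB x y : zr (Z.sub x y) = zr x - zr y.
Proof. by rewrite /zr -intrB -rmorphB. Qed.

Lemma zr0 : zr Z0 = 0.
Proof. by []. Qed.

Lemma zr1 : zr (Zpos xH) = 1.
Proof. by []. Qed.

Lemma zr_xO p : zr (Zpos (xO p)) = 2 * zr (Zpos p).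
Proof. by rewrite (zrM (Zpos (xO xH)) (Zpos p)). Qed.

Lemma zr_xI p : zr (Zpos (xI p)) = 2 * zr (Zpos p) + 1.
Proof. by rewrite -zr_xO -zr1 -zrD. Qed.

Lemma zr_neg p : zr (Zneg p) = - zr (Zpos p).
Proof. by rewrite -[RHS]sub0r -zr0 -zrB. Qed.

Definition zrE := (zr0, zr_neg, zr_xO, zr_xI, zr1).

Lemma zr_eq0 x : (zr x == 0) = (Z.eqb x Z0).
Proof.
rewrite /zr intr_eq0; case: x => [|p|p] //=.
- by apply/negbTE; rewrite -lt0n; lia.
Qed.

Lemma zr_gt0 x : (0 < zr x) = (Z.ltb Z0 x).
Proof.
rewrite /zr ltr0z; case: x => [|p|p] //=; by lia.
Qed.

Lemma zr_abs x : zr (Z.abs x) = `|zr x|.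
Proof.
rewrite /zr -intr_norm; congr (_%:~R); lia.
Qed.

Definition ev1 t (p : seq Z) : R := foldr (fun z r => zr z + t * r) 0 p.

Definition ev2 s t (p : poly2) : R := foldr (fun q r => ev1 t q + s * r) 0 p.

Definition ev_line s t (l : vec) : R :=
  zr l.1.1 * (1 - s - t) + zr l.1.2 * s + zr l.2 * t.

Lemma ev1_add t p q : ev1 t (zip_add Z.add p q) = ev1 t p + ev1 t q.
Proof.
elim: p q => [|x p IH] [|y q] /=; rewrite ?add0r ?addr0//.
by rewrite IH zrD; ring.
Qed.

Lemma ev2_add s t p q : ev2 s t (add2 p q) = ev2 s t p + ev2 s t q.
Proof.
elim: p q => [|x p IH] [|y q] /=; rewrite ?add0r ?addr0//.
by rewrite IH ev1_add; ring.
Qed.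

Lemma ev1_scale t c p : ev1 t (map (Z.mul c) p) = zr c * ev1 t p.
Proof. by elim: p => [|x p IH] /=; rewrite ?mulr0// IH zrM; ring. Qed.

Lemma ev2_scale s t c p : ev2 s t (scale2 c p) = zr c * ev2 s t p.
Proof. by elim: p => [|x p IH] /=; rewrite ?mulr0// IH ev1_scale; ring. Qed.

Lemma ev2_shift s t p : ev2 s t (map (cons Z0) p) = t * ev2 s t p.
Proof.
elim: p => [|x p IH] /=; first by rewrite mulr0.
by rewrite IH zr0; ring.
Qed.

Lemma ev2_mul_line s t l p : ev2 s t (mul_line l p) = ev_line s t l * ev2 s t p.
Proof.
case: l => [[l1 l2] l3] /=; rewrite !ev2_add /= ev2_shift !ev2_scale !zrB /ev_line /=.
by ring.
Qed.

Lemma ev1_eq0 t p : all (Z.eqb Z0) p -> ev1 t p = 0.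
Proof.
elim: p => [//|[|?|?] p IH] //= /IH ->.
by rewrite mulr0 addr0 /zr.
Qed.

Lemma ev2_eq0 s t p : all (all (Z.eqb Z0)) p -> ev2 s t p = 0.
Proof.
elim: p => [//|x p IH] /= /andP[/(ev1_eq0 t) -> /IH ->].
by rewrite mulr0 addr0.
Qed.

Definition ev_piece s t (m : nat) (P : pieces) : R := ev2 s t (nth [::] P m).

Lemma ev_piece_add s t m P Q :
  ev_piece s t m (add_pieces P Q) = ev_piece s t m P + ev_piece s t m Q.
Proof.
rewrite /ev_piece; elim: P Q m => [|p P IH] [|q Q] [|m] //=;
  by rewrite ?nth_nil ?add0r ?addr0 ?ev2_add.
Qed.

Lemma ev_piece_map s t m (f : poly2 -> poly2) (c : R) P :
  (forall p, ev2 s t (f p) = c * ev2 s t p) ->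
  ev_piece s t m (map f P) = c * ev_piece s t m P.
Proof.
move=> H; rewrite /ev_piece; have [mP|Pm] := ltnP m (size P).
  by rewrite (nth_map [::]).
by rewrite !nth_default ?size_map//= mulr0.
Qed.

Lemma ev_piece_scale s t m c P : ev_piece s t m (scale_pieces c P) = zr c * ev_piece s t m P.
Proof. by apply: ev_piece_map => p; rewrite ev2_scale. Qed.

Lemma ev_piece_mul_line s t m l P :
  ev_piece s t m (mul_line_pieces l P) = ev_line s t l * ev_piece s t m P.
Proof. by apply: ev_piece_map => p; rewrite ev2_mul_line. Qed.

Lemma ev_piece_eq s t m P Q : eq_pieces P Q -> ev_piece s t m P = ev_piece s t m Q.
Proof.
move=> PQ; apply/eqP; rewrite -subr_eq0; apply/eqP.
transitivity (ev_piece s t m (add_pieces P (scale_pieces (Zneg xH) Q))).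
  by rewrite ev_piece_add ev_piece_scale !zrE mulN1r.
rewrite /ev_piece; have [mP|Pm] := ltnP m (size (add_pieces P (scale_pieces (Zneg xH) Q))).
  exact/ev2_eq0/(all_nthP [::] PQ).
by rewrite nth_default.
Qed.

Definition ev_form (s u : R) (F : seq poly2) : R :=
  foldr (fun lp r => Num.max (ev_line s u lp.1) 0 ^+ 4 * ev2 s u lp.2 + r)
    (ev2 s u (nth [::] F 0)) (zip inner_lines (behead F)).

Lemma ev2_iter_mul_line (s u : R) n l p :
  ev2 s u (iter n (mul_line l) p) = ev_line s u l ^+ n * ev2 s u p.
Proof.
elim: n => [|n IH] /=; first by rewrite mul1r.
by rewrite ev2_mul_line IH exprS mulrA.
Qed.

(** An inner line has the same sign at all points of a cell, so that a truncated
power is either the full power or 0 there. *)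
Lemma ev2_on_cell (s u : R) (F : seq poly2) (c : vec) :
  (forall l, l \in split_lines -> 0 < ev_line s u l * zr (dot l c)) ->
  ev2 s u (on_cell F c) = ev_form s u F.
Proof.
move=> H; rewrite /on_cell /ev_form.
have {H} : forall l, l \in inner_lines -> 0 < ev_line s u l * zr (dot l c).
  by move=> l lL; apply: H; rewrite mem_cat lL orbT.
elim: inner_lines (behead F) => [|l L IH] [|p Ps] //= H.
have lc := H l (mem_head _ _); rewrite -{}IH; last first.
  by move=> l' l'L; apply: H; rewrite inE l'L orbT.
case: ifP => dc.
  rewrite ev2_add (ev2_iter_mul_line _ _ 4); congr (_ ^+ 4 * _ + _).
  by apply/esym/max_idPl; move: lc; rewrite pmulr_lgt0 ?zr_gt0// => /ltW.
have /max_idPr -> : ev_line s u l <= 0.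
  rewrite leNgt; apply: contraFN dc => lp.
  by move: lc; rewrite pmulr_rgt0// zr_gt0.
by rewrite expr0n /= mul0r add0r.
Qed.

End Evaluation.

(** * Simplex splines off the lines *)

Section Frame.
Context {R : realType} (v1 v2 v3 : R * R).
Local Notation a := (v2 - v1).
Local Notation b := (v3 - v1).
Local Notation v := (split12 v1 v2 v3).
Hypothesis ab0 : cross a b != 0.

Lemma coords_affine (p : R * R) (al be ga : R) :
  exists al' be' ga', forall y,
    affine_fun al be ga (coords p a b y) = affine_fun al' be' ga' y.
Proof.
exists ((al * b.2 - be * a.2) / cross a b), ((be * a.1 - al * b.1) / cross a b),
  (ga - (al * cross p b + be * cross a p) / cross a b) => y.
by rewrite /affine_fun /coords /=; rewrite /cross /=; ring.
Qed.

Definition node (j : nat) : R * R :=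
  (zr (bary12 j).1.2 / 12, zr (bary12 j).2 / 12).

Lemma split12_node (j : nat) : (0 < j <= 10)%N ->
  v j = from_coords v1 a b (node j).
Proof.
by case: j => [//|[|[|[|[|[|[|[|[|[|[|//]]]]]]]]]]] _;
  rewrite from_coordsE; apply: injective_projections;
  rewrite /= /GRing.scale /= !zrE; field.
Qed.

Lemma bary12_sum (j : nat) : (0 < j <= 10)%N ->
  zr (bary12 j).1.1 = 12 - zr (bary12 j).1.2 - zr (bary12 j).2 :> R.
Proof.
by case: j => [//|[|[|[|[|[|[|[|[|[|[|//]]]]]]]]]]] _; rewrite /= !zrE; ring.
Qed.

Definition line_at (x : R * R) (l : vec) : R :=
  ev_line (coords v1 a b x).1 (coords v1 a b x).2 l.

Lemma line_at_split12 (l : vec) (j : nat) : (0 < j <= 10)%N ->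
  line_at (v j) l = zr (dot l (bary12 j)) / 12.
Proof.
move=> jP; rewrite /line_at split12_node// from_coordsK// /ev_line /=.
have := bary12_sum jP; case: (bary12 j) l => [[x1 x2] x3] [[l1 l2] l3] /=.
by rewrite !(zrD, zrM) => ->; field.
Qed.

Lemma line_at_affine (l : vec) :
  exists al be ga, forall y, line_at y l = affine_fun al be ga y.
Proof.
case: (coords_affine v1 (zr l.1.2 - zr l.1.1) (zr l.2 - zr l.1.1) (zr l.1.1)).
move=> al [be [ga H]]; exists al, be, ga => y; rewrite -H.
by rewrite /line_at /ev_line /affine_fun; ring.
Qed.

Lemma line_at_comb (l : vec) (x : R * R) (K : seq nat) (be : nat -> R) :
  affine_coords v K x be ->
  12 * line_at x l = \sum_(1 <= j < 11) be j * zr (dot l (bary12 j)).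
Proof.
move=> [xE be1 _]; have [al [be' [ga H]]] := line_at_affine l.
rewrite H -xE affine_fun_comb// mulr_sumr big_nat [RHS]big_nat.
apply: eq_bigr => j jP; rewrite -H line_at_split12//.
by field.
Qed.

Lemma cross_split12 (i j k : nat) :
  (0 < i <= 10)%N -> (0 < j <= 10)%N -> (0 < k <= 10)%N ->
  cross (v j - v i) (v k - v i) = cross a b * zr (knot_det i j k) / 1728.
Proof.
move=> iP jP kP; rewrite !split12_node// !from_coordsE /node.
have := bary12_sum iP; have := bary12_sum jP; have := bary12_sum kP.
rewrite /knot_det /knot_line /cross.
case: (bary12 i) (bary12 j) (bary12 k) => [[x1 x2] x3] [[y1 y2] y3] [[z1 z2] z3] /=.
by rewrite !(zrD, zrM, zrB) => -> -> ->; field.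
Qed.

Lemma cross_line_at (x : R * R) (j k : nat) :
  (0 < j <= 10)%N -> (0 < k <= 10)%N ->
  cross (v j - x) (v k - x) = cross a b * line_at x (knot_line j k) / 144.
Proof.
move=> jP kP; rewrite /line_at -{1 2}(coordsK v1 ab0 x).
move: (coords v1 a b x) => [s t].
rewrite !split12_node// !from_coordsE /node.
have := bary12_sum jP; have := bary12_sum kP.
rewrite /knot_line /cross /ev_line.
case: (bary12 j) (bary12 k) => [[y1 y2] y3] [[z1 z2] z3] /=.
by rewrite !(zrD, zrM, zrB) => -> ->; field.
Qed.

Lemma node_in_triangle (j : nat) : (0 < j <= 10)%N -> @unit_triangle R (node j).
Proof.
by case: j => [//|[|[|[|[|[|[|[|[|[|[|//]]]]]]]]]]] _;
  split; rewrite /= !zrE; lra.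
Qed.

Lemma baseP (K : seq nat) :
  if base K is Some b then
    [/\ b.1.1 \in K, b.1.2 \in K, b.2 \in K &
        zr (knot_det b.1.1 b.1.2 b.2) != 0 :> R]
  else forall i j k, i \in K -> j \in K -> k \in K -> knot_det i j k = Z0.
Proof.
have mem_triples i j k : ((i, j, k) \in triples K) = [&& i \in K, j \in K & k \in K].
  rewrite /triples; apply/allpairsP/and3P => [[[ij k'] /= [/allpairsP[[i' j'] /= []]]]|].
    by rewrite !mem_undup => iK jK -> kK [-> -> ->].
  move=> [iK jK kK]; exists ((i, j), k); split; rewrite ?mem_undup//=.
  by apply: allpairs_f; rewrite mem_undup.
have mem_base i j k : ((i, j, k) \in [seq b <- triples K | noncollinear b]) =
    [&& ~~ Z.eqb (knot_det i j k) Z0, i \in K, j \in K & k \in K].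
  by rewrite mem_filter mem_triples.
rewrite /base; case: (seq.filter _ _) mem_base => [|[[i j] k] s] /= H.
- move=> i j k iK jK kK; apply/Z.eqb_eq; move: (H i j k).
  by rewrite iK jK kK !andbT in_nil => /esym/negbFE.
- by have := H i j k; rewrite mem_head => /esym/and4P[d0 -> -> ->]; rewrite zr_eq0.
Qed.

Definition in_cell (c : vec) (x : R * R) : Prop :=
  forall l, l \in split_lines -> 0 < line_at x l * zr (dot l c).

Lemma knot_line_okP (j k : nat) : (0 < j <= 6)%N -> (0 < k <= 6)%N -> j != k ->
  knot_line_ok j k.
Proof.
by case: j => [//|[|[|[|[|[|[|//]]]]]]] _; case: k => [//|[|[|[|[|[|[|//]]]]]]] _.
Qed.

(** A line through two of v1, ..., v6 is a multiple of a split line, and has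
therefore one sign on a cell. *)
Lemma in_cell_knot_line (c : vec) (x : R * R) (j k : nat) : in_cell c x ->
  (0 < j <= 6)%N -> (0 < k <= 6)%N -> j != k ->
  0 < line_at x (knot_line j k) * zr (dot (knot_line j k) c).
Proof.
move=> cx jP kP jk; have /hasP[l lL /andP[m0 /eqP ->]] := knot_line_okP jP kP jk.
move: (Z.div _ _) m0 => m; rewrite -(@zr_eq0 R) => m0.
rewrite (_ : _ * _ = zr m ^+ 2 * (line_at x l * zr (dot l c))).
  by rewrite mulr_gt0 ?exprn_even_gt0//; exact: cx.
case: l c {lL cx} => [[l1 l2] l3] [[c1 c2] c3].
by rewrite /line_at /ev_line /= !(zrD, zrM); ring.
Qed.

(** The coefficients in the recursion are picked by [get], which returns
admissible ones as soon as there are any: here the barycentric coordinates with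
respect to three noncollinear knots. *)
Lemma affine_coords_exists (K : seq nat) (x : R * R) (i j k : nat) :
  (forall l, l \in K -> (0 < l <= 6)%N) -> i \in K -> j \in K -> k \in K ->
  cross (v j - v i) (v k - v i) != 0 ->
  affine_coords v K x !=set0.
Proof.
move=> KP iK jK kK d0.
pose d := cross (v j - v i) (v k - v i).
pose bi := cross (v j - x) (v k - x) / d.
pose bj := cross (v k - x) (v i - x) / d.
pose bk := cross (v i - x) (v j - x) / d.
pose be l : R := bi * (l == i)%:R + bj * (l == j)%:R + bk * (l == k)%:R.
have sumE (F : nat -> R) : \sum_(1 <= l < 11) be l * F l = bi * F i + bj * F j + bk * F k.
  have one m : m \in K -> \sum_(1 <= l < 11) (l == m)%:R * F l = F m.
    move=> /KP /andP[m1 m6]; rewrite (bigD1_seq m) ?iota_uniq//=; last first.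
      by rewrite mem_index_iota m1 ltnS (leq_trans m6).
    rewrite eqxx mul1r big1 ?addr0// => l /negPf ->; by rewrite mul0r.
  rewrite -(one i iK) -(one j jK) -(one k kK) !mulr_sumr -!big_split /=.
  by apply: eq_bigr => l _; rewrite /be; ring.
exists be; split.
- apply: injective_projections; rewrite ?sum_fst ?sum_snd.
    rewrite (eq_bigr (fun l => be l * (v l).1))// sumE /bi /bj /bk /d.
    by move: d0; rewrite /cross /= => d0; field.
  rewrite (eq_bigr (fun l => be l * (v l).2))// sumE /bi /bj /bk /d.
  by move: d0; rewrite /cross /= => d0; field.
- rewrite (eq_bigr (fun l => be l * 1)) => [|l _]; last by rewrite mulr1.
  rewrite (sumE (fun=> 1)) /bi /bj /bk /d.
  by move: d0; rewrite /cross /= => d0; field.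
- move=> l lK; rewrite /be.
  have ne m : m \in K -> (l == m)%:R = 0 :> R.
    by move=> mK; case: eqP => [lm|//]; rewrite lm mK in lK.
  by rewrite !ne// !mulr0 !addr0.
Qed.

Lemma lookup_all (p : pred (seq nat * pieces)) (t : table) (K : seq nat)
    (P : pieces) : all p t -> lookup t K = Some P -> p (K, P).
Proof.
elim: t => [//|[K' P'] t IH] /= /andP[pK' /IH {}IH].
by case: eqP => [<- [<-]//|_]; exact: IH.
Qed.

Lemma ev_piece_cramer s t m (F : vec -> pieces -> pieces) (f : vec -> R) b P1 P2 P3 :
  (forall l P, ev_piece s t m (F l P) = f l * ev_piece s t m P) ->
  ev_piece s t m (cramer F b (P1, P2, P3)) =
  f (knot_line b.1.2 b.2) * ev_piece s t m P1 + (f (knot_line b.2 b.1.1) * ev_piece s t m P2 +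
  f (knot_line b.1.1 b.1.2) * ev_piece s t m P3).
Proof. by move=> H; case: b => [[i j] k] /=; rewrite !ev_piece_add !H. Qed.

Lemma line_at_scale x c l : line_at x (scalev c l) = zr c * line_at x l.
Proof. by case: l => [[? ?] ?]; rewrite /line_at /ev_line /= !zrM; ring. Qed.

Lemma cross_split12_neq0 (i j k : nat) :
  (0 < i <= 10)%N -> (0 < j <= 10)%N -> (0 < k <= 10)%N ->
  zr (knot_det i j k) != 0 :> R -> cross (v j - v i) (v k - v i) != 0.
Proof.
move=> iP jP kP d0; rewrite (cross_split12 iP jP kP).
apply: mulf_neq0; first exact: mulf_neq0.
by apply: invr_neq0; rewrite pnatr_eq0.
Qed.

Lemma triangle_at_split12 (j : nat) : (0 < j <= 10)%N -> triangle_at v1 a b (v j).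
Proof.
by move=> jP; exists (node j); [exact: node_in_triangle|rewrite split12_node].
Qed.

Lemma area_hull_base (K : seq nat) : all (fun j => 0 < j <= 6)%N K ->
  (area (hull v K) == 0) = ~~ base K.
Proof.
move=> /allP K6; have K10 l : l \in K -> (0 < l <= 10)%N.
  by move=> /K6 /andP[-> /leq_trans ->].
have := baseP K; case: (base K) => [[[i j] k] /= [iK jK kK d0]|d0].
  apply/negbTE/(area_hull_neq0 ab0 _ iK jK kK) => [l /K10|].
    exact: triangle_at_split12.
  exact: cross_split12_neq0 (K10 _ iK) (K10 _ jK) (K10 _ kK) d0.
apply/eqP/area_hull_collinear => i j k iK jK kK.
by rewrite (cross_split12 (K10 _ iK) (K10 _ jK) (K10 _ kK)) d0// mulr0 mul0r.
Qed.

Lemma area_ratio (i j k : nat) :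
  (0 < i <= 10)%N -> (0 < j <= 10)%N -> (0 < k <= 10)%N ->
  zr (knot_det i j k) != 0 :> R ->
  area (triangle v) / area (hull v [:: i; j; k]) = 1728 / `|zr (knot_det i j k)|.
Proof.
move=> iP jP kP d0; have m0 : fine (@lebesgue2 R unit_triangle) != 0.
  by rewrite gt_eqF// fine_gt0// lebesgue2_unit_triangle.
have E := cross_split12_neq0 iP jP kP d0.
rewrite /triangle (area_hull3 E) (@area_hull3 _ v 1 2 3 ab0).
rewrite (cross_split12 iP jP kP) !normrM normfV.
by rewrite (ger0_norm (ler0n _ 1728)); field; rewrite m0 !normr_eq0 ab0 d0.
Qed.

(** Both sides are sign conditions on lines through two of the knots, which have
one sign on a cell. *)
Lemma mem_hull3_inside (c : vec) (x : R * R) (i j k : nat) :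
  in_cell c x -> (0 < i <= 6)%N -> (0 < j <= 6)%N -> (0 < k <= 6)%N ->
  zr (knot_det i j k) != 0 :> R ->
  hull v [:: i; j; k] x <-> inside i j k c.
Proof.
move=> cx iP jP kP d0.
have le6 l : (0 < l <= 6)%N -> (0 < l <= 10)%N by move=> /andP[-> /leq_trans ->].
have E := cross_split12 (le6 _ iP) (le6 _ jP) (le6 _ kP).
have E0 := cross_split12_neq0 (le6 _ iP) (le6 _ jP) (le6 _ kP) d0.
have ij : i != j.
  by apply: contraNneq E0 => ->; apply/eqP; rewrite /cross /=; ring.
have jk : j != k.
  by apply: contraNneq E0 => ->; apply/eqP; rewrite /cross /=; ring.
have ki : k != i.
  by apply: contraNneq E0 => ->; apply/eqP; rewrite /cross /=; ring.
have C p q (pP : (0 < p <= 6)%N) (qP : (0 < q <= 6)%N) :=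
  cross_line_at x (le6 _ pP) (le6 _ qP).
have S p q : (0 < p <= 6)%N -> (0 < q <= 6)%N -> p != q ->
    (0 <= cross (v p - x) (v q - x) / cross (v j - v i) (v k - v i)) =
    Z.ltb Z0 (Z.mul (knot_det i j k) (dot (knot_line p q) c)).
  move=> pP qP pq; rewrite C// E -(@zr_gt0 R) zrM.
  have := in_cell_knot_line cx pP qP pq.
  move: (zr (knot_det i j k)) d0 => d d0.
  move: (line_at _ _) (zr _) => L D LD.
  have L0 : L != 0 by apply: contraTneq LD => ->; rewrite mul0r ltxx.
  have D0 : D != 0 by apply: contraTneq LD => ->; rewrite mulr0 ltxx.
  rewrite (_ : _ / _ = 12 * (L * D) / (d * D) ); last first.
    by field; rewrite d0 D0 ab0.
  rewrite pmulr_rge0; last by rewrite mulr_gt0.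
  by rewrite invr_ge0 lt0r mulf_eq0 (negPf d0) (negPf D0).
rewrite hull3; last by rewrite /= !inE negb_or ij jk eq_sym ki.
rewrite (triangle_atP _ _ E0); rewrite /inside -!S//.
rewrite /unit_triangle /coords /=.
set q1 := (_ / _); set q2 := (_ / _).
set r1 := (_ / _); set r2 := (_ / _); set r3 := (_ / _).
have -> : r2 = q1 by rewrite /r2 /q1 /cross /=; congr (_ / _); ring.
have -> : r3 = q2 by rewrite /r3 /q2 /cross /=; congr (_ / _); ring.
have -> : r1 = 1 - q1 - q2.
  rewrite /r1 /q1 /q2; move: E0; rewrite /cross /= => E0; by field.
split; first by move=> [h1 h2 h3]; apply/and3P; split; lra.
by move=> /and3P[h1 h2 h3]; split; lra.
Qed.

#[local] Arguments cramer : simpl never.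
#[local] Arguments subpieces : simpl never.
#[local] Arguments indicator_pieces : simpl never.
#[local] Arguments coords : simpl never.
#[local] Arguments ev_piece : simpl never.

(** Induction along the recursion.  The coefficients picked there may involve
all knots; the second test of [entry_ok] reduces them to those on [base K]. *)
Lemma simplex_spline_recE (t : table) (x : R * R) (m n : nat) (K : seq nat)
    (P : pieces) : all (entry_ok t) t -> (m < size cells)%N ->
  in_cell (nth (Z0, Z0, Z0) cells m) x -> lookup t K = Some P ->
  size K = n.+3 ->
  simplex_spline_rec v n K x =
  ev_piece (coords v1 a b x).1 (coords v1 a b x).2 m P.
Proof.
move=> tok mc cx; set s := (coords v1 a b x).1; set u := (coords v1 a b x).2.
elim: n K P => [|n IH] K P KP Kn.
all: have := lookup_all tok KP; rewrite /entry_ok => /andP[K6].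
all: have K10 l : l \in K -> (0 < l <= 10)%N
  by move=> /(allP K6) /andP[-> /leq_trans ->].
all: have := area_hull_base K6; rewrite /= => ->.
all: have := baseP K; case: (base K) => [[[i j] k] /= [iK jK kK d0]|_ /eqP ->];
  last by rewrite /ev_piece nth_nil.
- rewrite Kn eqxx => /andP[/eqP KE /(ev_piece_eq s u m)].
  rewrite ev_piece_scale zr_abs [X in _ = X]/ev_piece /indicator_pieces.
  rewrite (nth_map (Z0, Z0, Z0))// => H.
  apply: (@mulfI _ `|zr (knot_det i j k)|); first by rewrite normr_eq0.
  rewrite H KE area_ratio ?K10// indicE.
  have := mem_hull3_inside cx (allP K6 _ iK) (allP K6 _ jK) (allP K6 _ kK) d0.
  case: inside => [[_ /(_ isT)]|[h _]].
    by move=> h; rewrite mem_set//= !zrE /=; field; rewrite normr_eq0.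
  by rewrite memNset ?mul0r ?mulr0//= => /h.
- rewrite Kn /= => /andP[/(ev_piece_eq s u m) HP /allP Hrem].
  have [be beP] : affine_coords v K x !=set0.
    apply: (affine_coords_exists x (allP K6) iK jK kK).
    exact: cross_split12_neq0 (K10 _ iK) (K10 _ jK) (K10 _ kK) d0.
  have {beP} := @getPex _ (affine_coords v K x) (ex_intro _ be beP).
  move: (get _) => {}be beP.
  apply: (mulfI d0); move: HP; rewrite ev_piece_scale => ->.
  rewrite /subpieces (ev_piece_cramer _ _ _ _ (fun l P => ev_piece_mul_line _ _ _ _ P)) /=.
  have EL l : ev_line s u (scalev 12 l) =
     \sum_(1 <= q < 11) be q * zr (dot l (bary12 q)).
    rewrite -(line_at_comb _ beP) -[LHS]/(line_at x (scalev 12 l)) line_at_scale.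
    by congr (_ * _); rewrite !zrE; ring.
  rewrite !EL !mulr_suml -!big_split mulr_sumr /=; apply: eq_bigr => l _.
  have [lK|lK] := boolP (l \in K); last first.
    by case: beP => _ _ /(_ _ lK) ->; rewrite !(mul0r, mulr0, addr0).
  have := Hrem l; rewrite mem_undup => /(_ lK).
  case ElQ: (lookup t (rem l K)) => [Q|//].
  move/(ev_piece_eq s u m).
  rewrite ev_piece_scale /subpieces.
  rewrite (ev_piece_cramer _ _ _ _ (fun L P => ev_piece_scale _ _ _ _ P)) /= => HQ.
  rewrite (IH _ _ ElQ) ?size_rem ?Kn//.
  rewrite mulrCA HQ; ring.
Qed.

Definition line_pairs : seq (nat * nat) :=
  [:: (2, 3); (1, 3); (1, 2); (1, 5); (2, 6); (3, 4); (4, 6); (4, 5); (5, 6)]%N.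

(** The points excluded by [off_lines] lie on lines through two vertices, and
every split line is such a line. *)
Lemma split_line_knots (l : vec) : l \in split_lines ->
  exists j k m, [/\ (0 < j < k)%N, (k <= 10)%N, zr m != 0 :> R,
    knot_line j k = scalev m l & v j != v k].
Proof.
have H : all (fun l => has (fun jk =>
    let m := Z.div (dot (knot_line jk.1 jk.2) l) (dot l l) in
    ~~ Z.eqb m Z0 && (knot_line jk.1 jk.2 == scalev m l)) line_pairs) split_lines.
  by vm_compute.
move=> /(allP H) /hasP[[j k] jk /= /andP[m0 /eqP E]].
exists j, k, (Z.div (dot (knot_line j k) l) (dot l l)); rewrite zr_eq0.
have Hp : all (fun p => (0 < p.1 < p.2)%N && (p.2 <= 10)%N &&
    (bary12 p.1 != bary12 p.2)) line_pairs by vm_compute.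
have /andP[/andP[/= jk0 k10] bjk] := allP Hp _ jk; split => //.
have jP : (0 < j <= 10)%N.
  by case/andP: jk0 => -> /ltnW h; rewrite (leq_trans h).
have kP : (0 < k <= 10)%N by rewrite k10 andbT; case/andP: jk0 => _; exact: leq_ltn_trans.
apply: contra bjk => /eqP vjk; apply/eqP.
have [] : node j = node k.
  by apply: (can_inj (from_coordsK v1 ab0)); rewrite -!split12_node.
have t0 : 12 != 0 :> R by rewrite pnatr_eq0.
have zr_inj z w : zr z = zr w :> R -> z = w.
  move/eqP; rewrite -subr_eq0 -zrB zr_eq0 => /Z.eqb_eq; lia.
move=> /(mulIf (invr_neq0 t0)) h2 /(mulIf (invr_neq0 t0)) h3.
have h1 : zr (bary12 j).1.1 = zr (bary12 k).1.1 :> R by rewrite !bary12_sum// h2 h3.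
move: h1 h2 h3; case: (bary12 j) (bary12 k) => [[? ?] ?] [[? ?] ?] /=.
by move=> /zr_inj -> /zr_inj -> /zr_inj ->.
Qed.

Lemma off_lines_line_at (x : R * R) (l : vec) : off_lines v x ->
  l \in split_lines -> line_at x l != 0.
Proof.
move=> xoff /split_line_knots[j [k [m [jk k10 m0 E vjk]]]].
apply/negP => /eqP x0; apply: (xoff j k jk k10).
have jP : (0 < j <= 10)%N.
  by case/andP: jk => -> /ltnW jk; rewrite (leq_trans jk).
have kP : (0 < k <= 10)%N by rewrite k10 andbT; case/andP: jk => _; exact: leq_ltn_trans.
have := cross_line_at x jP kP; rewrite E line_at_scale x0 !mulr0 mul0r.
move: vjk; case: (v j) (v k) x {x0 xoff} => [y1 y2] [z1 z2] [x1 x2] yz.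
rewrite /cross /= => h; have [e1|n1] := eqVneq (z1 - y1) 0; last first.
  exists ((x1 - y1) / (z1 - y1)).
  apply: injective_projections; rewrite /= /GRing.scale /=; first by field.
  apply: (mulIf n1); rewrite mulrDl mulrAC (divfK n1).
  by transitivity (x2 * (z1 - y1)); [|lra].
have n2 : z2 - y2 != 0.
  apply: contra yz => /eqP e2; apply/eqP; congr (_, _); lra.
exists ((x2 - y2) / (z2 - y2)).
apply: injective_projections; rewrite /= /GRing.scale /=; last by field.
rewrite e1 mulr0 addr0; apply: (mulIf n2).
have z1y : z1 = y1 by lra.
by rewrite z1y in h; lra.
Qed.

Lemma mul_sign_gt0 (x : R) (z : Z) :
  (if Z.ltb Z0 z then 0 < x else Z.ltb z Z0 && (x < 0)) -> 0 < x * zr z.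
Proof.
case: ifP => [z0 x0|_ /andP[z0 x0]]; first by rewrite mulr_gt0// zr_gt0.
rewrite -mulrNN mulr_gt0 ?oppr_gt0// -[zr z]opprK oppr_lt0 -[- zr z]sub0r -zr0.
by rewrite -zrB zr_gt0; lia.
Qed.

(** The signs of the medians sort the barycentric coordinates, and those of the
other three inner lines compare each coordinate with the sum of the other two,
that is, with 1/2.  Exactly twelve sign patterns are consistent, and they are the
patterns of the twelve cells. *)
Lemma cell_exists (s u : R) : 0 < 1 - s - u -> 0 < s -> 0 < u ->
  (forall l, l \in inner_lines -> ev_line s u l != 0) ->
  exists2 m, (m < size cells)%N & forall l, l \in split_lines ->
    0 < ev_line s u l * zr (dot l (nth (Z0, Z0, Z0) cells m)).
Proof.
move=> p0 s0 u0 H.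
have {}H (n : nat) (x y : R) : (n < 6)%N ->
    ev_line s u (nth (Z0, Z0, Z0) inner_lines n) = y - x ->
    ev_line s u (nth (Z0, Z0, Z0) inner_lines n) < 0 /\ y < x \/
    0 < ev_line s u (nth (Z0, Z0, Z0) inner_lines n) /\ x < y.
  move=> n6 E; have : ev_line s u (nth (Z0, Z0, Z0) inner_lines n) != 0.
    by apply: H; exact: mem_nth.
  by rewrite neq_lt E subr_lt0 subr_gt0 => /orP[]; [left|right].
pose ok m := all (fun l =>
  let z := dot l (nth (Z0, Z0, Z0) cells m) in
  if Z.ltb Z0 z then 0 < ev_line s u l else Z.ltb z Z0 && (ev_line s u l < 0))
  split_lines.
suff [m m12 /allP okm] : exists2 m, (m < size cells)%N & ok m.
  by exists m => // l lL; apply: mul_sign_gt0; exact: okm.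
have E l : ev_line s u l = zr l.1.1 * (1 - s - u) + zr l.1.2 * s + zr l.2 * u by [].
have o6 : 0 < ev_line s u (nth (Z0, Z0, Z0) split_lines 0).
  by rewrite E /= !zrE !mul0r mul1r !addr0.
have o7 : 0 < ev_line s u (nth (Z0, Z0, Z0) split_lines 1).
  by rewrite E /= !zrE !mul0r mul1r addr0 add0r.
have o8 : 0 < ev_line s u (nth (Z0, Z0, Z0) split_lines 2).
  by rewrite E /= !zrE !mul0r mul1r !add0r.
have [p pE] : exists p, p = 1 - s - u by eexists.
have h0 := H 0%N s u isT ltac:(by rewrite E /= !zrE ?pE; ring).
have h1 := H 1%N p u isT ltac:(by rewrite E /= !zrE ?pE; ring).
have h2 := H 2%N p s isT ltac:(by rewrite E /= !zrE ?pE; ring).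
have h3 := H 3%N p (s + u) isT ltac:(by rewrite E /= !zrE ?pE; ring).
have h4 := H 4%N (p + u) s isT ltac:(by rewrite E /= !zrE ?pE; ring).
have h5 := H 5%N (p + s) u isT ltac:(by rewrite E /= !zrE ?pE; ring).
rewrite -pE in p0; rewrite /= {pE E H} in o6 o7 o8 h0 h1 h2 h3 h4 h5 *.
move: h0 h1 h2 => [[n0 m0]|[n0 m0]] [[n1 m1]|[n1 m1]] [[n2 m2]|[n2 m2]].
all: try by clear -m0 m1 m2; exfalso; lra.
all: case: h3 => [[n3 m3]|[n3 m3]]; try by clear -p0 s0 u0 m0 m1 m2 m3; exfalso; lra.
all: case: h4 => [[n4 m4]|[n4 m4]]; try by clear -p0 s0 u0 m0 m1 m2 m3 m4; exfalso; lra.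
all: case: h5 => [[n5 m5]|[n5 m5]];
  try by clear -p0 s0 u0 m0 m1 m2 m3 m4 m5; exfalso; lra.
(* The twelve consistent patterns and their cells. *)
 12: exists 5%N.
 11: exists 11%N.
 10: exists 4%N.
 9: exists 10%N.
 8: exists 7%N.
 7: exists 1%N.
 6: exists 3%N.
 5: exists 9%N.
 4: exists 2%N.
 3: exists 8%N.
 2: exists 6%N.
 1: exists 0%N.
all: by rewrite /ok //= n0 n1 n2 n3 n4 n5 o6 o7 o8.
Qed.

Lemma triangle_split12 : triangle v = triangle_at v1 a b.
Proof. exact: hull3. Qed.

Lemma exists_in_cell (x : R * R) : triangle v x -> off_lines v x ->
  exists2 m, (m < size cells)%N & in_cell (nth (Z0, Z0, Z0) cells m) x.
Proof.
rewrite triangle_split12 => /(triangle_atP _ _ ab0) [s0 u0 su1] xoff.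
have n0 l : l \in split_lines -> line_at x l != 0 by exact: off_lines_line_at.
have [m mc cm] : exists2 m, (m < size cells)%N & forall l, l \in split_lines ->
    0 < ev_line (coords v1 a b x).1 (coords v1 a b x).2 l *
        zr (dot l (nth (Z0, Z0, Z0) cells m)).
  have := n0 _ (mem_nth (Z0, Z0, Z0) (isT : (0 < size split_lines)%N)).
  have := n0 _ (mem_nth (Z0, Z0, Z0) (isT : (1 < size split_lines)%N)).
  have := n0 _ (mem_nth (Z0, Z0, Z0) (isT : (2 < size split_lines)%N)).
  rewrite /line_at /ev_line /= !zrE !mul1r !mul0r !addr0 !add0r => n2 n1 n3.
  apply: cell_exists.
  - by rewrite lt0r n3; move: su1; rewrite /=; lra.
  - by rewrite lt0r n1.
  - by rewrite lt0r n2.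
  - by move=> l lL; apply: n0; rewrite mem_cat lL orbT.
by exists m.
Qed.

Lemma simplex_splineE (t : table) (K : seq nat) (P : pieces) (x : R * R) :
  all (entry_ok t) t -> lookup t K = Some P -> size K = 8%N -> form_ok P ->
  triangle v x -> off_lines v x ->
  simplex_spline v K x =
  ev_form (coords v1 a b x).1 (coords v1 a b x).2 (cross_form P).
Proof.
move=> tok KP K8 PF xT xoff; have [m mc cx] := exists_in_cell xT xoff.
rewrite /simplex_spline K8 (simplex_spline_recE tok mc cx KP)//.
rewrite (ev_piece_eq _ _ m PF) /ev_piece (nth_map (Z0, Z0, Z0))//.
exact: ev2_on_cell.
Qed.

End Frame.

(** * Functions of class C^n and Taylor expansion *)

(** The derivative in direction d is required to be linear in d, with partial
derivatives that are again of class C^(n-1); in this form the product rule and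
differentiation along lines are immediate. *)
Fixpoint smooth {R : realType} (n : nat) (G : R * R -> R) : Prop :=
  continuous G /\
  if n is n'.+1 then
    exists g1 g2, [/\ forall x d, is_derive x d G (d.1 * g1 x + d.2 * g2 x),
                      smooth n' g1 & smooth n' g2]
  else True.

Lemma smooth_continuous {R : realType} n (G : R * R -> R) :
  smooth n G -> continuous G.
Proof. by case: n => [|n] []. Qed.

Lemma smoothW {R : realType} n (G : R * R -> R) : smooth n.+1 G -> smooth n G.
Proof.
elim: n G => [|n IH] G [cG [g1 [g2 [dG h1 h2]]]]; first by split.
by split => //; exists g1, g2; split => //; exact: IH.
Qed.

Lemma smooth_cst {R : realType} n (k : R) : smooth n (fun=> k).
Proof.
elim: n k => [|n IH] k; split => //; try exact: cst_continuous.
exists (fun=> 0), (fun=> 0); split => // x d.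
by rewrite !mulr0 addr0; exact: is_derive_cst.
Qed.

Lemma smooth_add {R : realType} n (F G : R * R -> R) :
  smooth n F -> smooth n G -> smooth n (fun x => F x + G x).
Proof.
elim: n F G => [|n IH] F G [cF dF] [cG dG].
  by split => // x; apply: cvgD; [exact: cF|exact: cG].
split; first by move=> x; apply: cvgD; [exact: cF|exact: cG].
have [f1 [f2 [DF sf1 sf2]]] := dF; have [g1 [g2 [DG sg1 sg2]]] := dG.
exists (fun x => f1 x + g1 x), (fun x => f2 x + g2 x).
split; try exact: IH.
move=> x d; have := DF x d; have := DG x d => {}DG {}DF.
have := is_deriveD DF DG; congr (is_derive _ _ _ _); ring.
Qed.

Lemma smooth_mul {R : realType} n (F G : R * R -> R) :
  smooth n F -> smooth n G -> smooth n (fun x => F x * G x).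
Proof.
elim: n F G => [|n IH] F G sF sG; have cF := smooth_continuous sF;
  have cG := smooth_continuous sG.
  by split => // x; apply: cvgM; [exact: cF|exact: cG].
split; first by move=> x; apply: cvgM; [exact: cF|exact: cG].
have sF' := smoothW sF; have sG' := smoothW sG.
case: sF => _ [f1 [f2 [DF sf1 sf2]]]; case: sG => _ [g1 [g2 [DG sg1 sg2]]].
exists (fun x => F x * g1 x + G x * f1 x), (fun x => F x * g2 x + G x * f2 x).
split; try by apply: smooth_add; exact: IH.
move=> x d; have := DF x d; have := DG x d => {}DG {}DF.
have := is_deriveM DF DG; congr (is_derive _ _ _ _).
by rewrite /GRing.scale /=; ring.
Qed.

Lemma smooth_exp {R : realType} n k (F : R * R -> R) :
  smooth n F -> smooth n (fun x => F x ^+ k).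
Proof.
move=> sF; elim: k => [|k IH].
  by under eq_fun do rewrite expr0; exact: smooth_cst.
by under eq_fun do rewrite exprS; exact: smooth_mul.
Qed.

(** A quadratic bound on the remainder, uniform in the sign of h, treats the kink
of a truncated power like any other point. *)
Lemma is_derive_quadratic {R : realType} (G : R * R -> R) (x d : R * R) (D C : R) :
  0 <= C ->
  (forall h : R, `|G (h *: d + x) - G x - h * D| <= C * h ^+ 2) ->
  is_derive x d G D.
Proof.
move=> C0 H.
have cv : (fun h : R => h^-1 *: ((G \o shift x) (h *: d) - G x)) @ 0^' --> D.
  apply/cvgrPdist_le => e e0; near=> h.
  have h0 : h != 0 by near: h; exact: nbhs_dnbhs_neq.
  have hC : `|h| < e / (C + 1).
    by near: h; apply: dnbhs0_lt; rewrite divr_gt0// ltr_wpDl.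
  rewrite /= (_ : D - _ = - (h^-1 * (G (h *: d + x) - G x - h * D))); last first.
    by rewrite /GRing.scale /=; field.
  rewrite normrN normrM normfV ler_pdivrMl ?normr_gt0//.
  apply: le_trans (H h) _; rewrite -(real_normK (num_real h)) expr2 mulrCA.
  rewrite ler_wpM2l//; move: hC; rewrite ltr_pdivlMr ?ltr_wpDl// => hC.
  by apply: le_trans (ltW hC); rewrite mulrC ler_wpM2l// lerDl.
by apply: DeriveDef; [apply/cvg_ex; exists D|exact: cvg_lim].
Unshelve. all: by end_near.
Qed.

Lemma continuous_affine_fun {R : realType} (al be ga : R) :
  continuous (affine_fun al be ga).
Proof.
move=> x; apply: cvgD; last exact: cvg_cst.
by apply: cvgD; apply: cvgM; [exact: cvg_cst|exact: cvg_fst|exact: cvg_cst|exact: cvg_snd].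
Qed.

Lemma affine_fun_shift {R : realType} (al be ga h : R) (x d : R * R) :
  affine_fun al be ga (h *: d + x) =
  affine_fun al be ga x + h * (d.1 * al + d.2 * be).
Proof. by rewrite /affine_fun /= /GRing.scale /=; ring. Qed.

Lemma is_derive_affine {R : realType} (al be ga : R) (x d : R * R) :
  is_derive x d (affine_fun al be ga) (d.1 * al + d.2 * be).
Proof.
apply: (@is_derive_quadratic _ _ _ _ _ 0) => // h; rewrite affine_fun_shift.
by rewrite (_ : _ - _ - _ = 0) ?normr0 ?mul0r//; ring.
Qed.

Lemma smooth_affine {R : realType} n (al be ga : R) : smooth n (affine_fun al be ga).
Proof.
case: n => [|n]; split => //; try exact: continuous_affine_fun.
exists (fun=> al), (fun=> be); split; try exact: smooth_cst.
by move=> x d; exact: is_derive_affine.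
Qed.

Definition pos_part {R : realType} (l : R * R -> R) (x : R * R) : R :=
  Num.max (l x) 0.

Lemma continuous_pos_part {R : realType} (al be ga : R) :
  continuous (pos_part (affine_fun al be ga)).
Proof.
move=> x; apply: (@continuous_max _ _ (affine_fun al be ga) (fun=> 0)).
  exact: continuous_affine_fun.
exact: cst_continuous.
Qed.

Lemma pos_part_sqr_quadratic {R : realType} (s h : R) :
  `|Num.max (s + h) 0 ^+ 2 - Num.max s 0 ^+ 2 - h * (2 * Num.max s 0)| <= h ^+ 2.
Proof.
rewrite ler_norml; case: (leP s 0) => s0; case: (leP (s + h) 0) => sh;
  apply/andP; split; nra.
Qed.

Lemma is_derive_pos_part_sqr {R : realType} (al be ga : R) (x d : R * R) :
  is_derive x d (fun y => pos_part (affine_fun al be ga) y ^+ 2)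
    ((d.1 * al + d.2 * be) * (2 * pos_part (affine_fun al be ga) x)).
Proof.
apply: (@is_derive_quadratic _ _ _ _ _ ((d.1 * al + d.2 * be) ^+ 2)).
  exact: sqr_ge0.
move=> h; rewrite /pos_part affine_fun_shift mulrA -exprMn [_ * h]mulrC.
exact: pos_part_sqr_quadratic.
Qed.

(** From l * max(l, 0)^n = max(l, 0)^(n+1), for n > 0, the product rule yields all
powers from the square. *)
Lemma is_derive_pos_part {R : realType} n (al be ga : R) (x d : R * R) :
  is_derive x d (fun y => pos_part (affine_fun al be ga) y ^+ n.+2)
    ((d.1 * al + d.2 * be) * (n.+2%:R * pos_part (affine_fun al be ga) x ^+ n.+1)).
Proof.
elim: n => [|n IH]; first exact: is_derive_pos_part_sqr.
have mulE y m : pos_part (affine_fun al be ga) y ^+ m.+2 =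
    affine_fun al be ga y * pos_part (affine_fun al be ga) y ^+ m.+1.
  rewrite exprS /pos_part; case: leP => // _.
  by rewrite exprS !mul0r mulr0.
under eq_fun do rewrite mulE.
have := is_deriveM (is_derive_affine al be ga x d) IH; congr (is_derive _ _ _ _).
rewrite /GRing.scale /= !mulE -(natr1 n.+2).
by ring.
Qed.

Lemma smooth_pos_part {R : realType} n (al be ga : R) :
  smooth n (fun x => pos_part (affine_fun al be ga) x ^+ n.+1.+1).
Proof.
have cX k : continuous (fun x => pos_part (affine_fun al be ga) x ^+ k).
  apply: (@smooth_continuous _ 0); apply: smooth_exp.
  by split => //; exact: continuous_pos_part.
elim: n => [|n IH]; split => //.
exists (fun x => (n.+3%:R * al) * pos_part (affine_fun al be ga) x ^+ n.+2).
exists (fun x => (n.+3%:R * be) * pos_part (affine_fun al be ga) x ^+ n.+2).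
split; try (by apply: smooth_mul => //; exact: smooth_cst).
move=> x d; have := is_derive_pos_part n.+1 al be ga x d.
by congr (is_derive _ _ _ _); ring.
Qed.

#[local] Arguments smooth : simpl never.

Section SmoothForm.
Context {R : realType} (v1 v2 v3 : R * R).
Local Notation a := (v2 - v1).
Local Notation b := (v3 - v1).

Lemma smooth_affine_coords n (al be ga : R) :
  smooth n (fun x => affine_fun al be ga (coords v1 a b x)).
Proof.
have [al' [be' [ga' H]]] := coords_affine v1 v2 v3 v1 al be ga.
by under eq_fun do rewrite H; exact: smooth_affine.
Qed.

Lemma smooth_coords1 n : smooth n (fun x => (coords v1 a b x).1).
Proof.
have := smooth_affine_coords n 1 0 0; congr (smooth _ _).
by apply/funext => x; rewrite /affine_fun mul1r mul0r !addr0.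
Qed.

Lemma smooth_coords2 n : smooth n (fun x => (coords v1 a b x).2).
Proof.
have := smooth_affine_coords n 0 1 0; congr (smooth _ _).
by apply/funext => x; rewrite /affine_fun mul1r mul0r addr0 add0r.
Qed.

Lemma smooth_ev2 n (p : poly2) :
  smooth n (fun x => ev2 (coords v1 a b x).1 (coords v1 a b x).2 p).
Proof.
have ev1s (q : seq Z) : smooth n (fun x => ev1 (coords v1 a b x).2 q).
  elim: q => [|z q IH] /=; first exact: smooth_cst.
  apply: smooth_add; first exact: smooth_cst.
  by apply: smooth_mul => //; exact: smooth_coords2.
elim: p => [|q p IH] /=; first exact: smooth_cst.
apply: smooth_add; first exact: ev1s.
by apply: smooth_mul => //; exact: smooth_coords1.
Qed.

Lemma smooth_ev_form (F : seq poly2) :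
  smooth 2 (fun x => ev_form (coords v1 a b x).1 (coords v1 a b x).2 F).
Proof.
rewrite /ev_form; elim: (zip _ _) => [|[l p] L IH] /=; first exact: smooth_ev2.
apply: smooth_add => //; apply: smooth_mul; last exact: smooth_ev2.
have [al [be [ga H]]] := line_at_affine v1 v2 v3 l.
have := smooth_pos_part 2 al be ga; congr (smooth _ _).
by apply/funext => x; rewrite /pos_part -H.
Qed.

End SmoothForm.

Lemma smooth_hessian {R : realType} (G : R * R -> R) : smooth 2 G ->
  exists (g : 'I_2 -> R * R -> R) (H : 'I_2 -> 'I_2 -> R * R -> R),
  [/\ forall x d, is_derive x d G (d.1 * g 0 x + d.2 * g 1 x),
      forall i x d, is_derive x d (g i) (d.1 * H i 0 x + d.2 * H i 1 x),
      forall i, continuous (g i) &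
      forall i j, continuous (H i j)].
Proof.
move=> [_ [g1 [g2 [DG [c1 [h11 [h12 [D1 [k11 _] [k12 _]]]]] s2]]]].
case: s2 => [c2 [h21 [h22 [D2 [k21 _] [k22 _]]]]].
pose pick2 (T : Type) (y z : T) (i : 'I_2) := if i == 0 then y else z.
exists (pick2 _ g1 g2), (pick2 _ (pick2 _ h11 h12) (pick2 _ h21 h22)).
by split=> [x d|[[|[|//]]] i x d|[[|[|//]]] i|[[|[|//]]] i [[|[|//]]] j] //=.
Qed.

Lemma is_derive_line {R : realType} (G : R * R -> R) (x d : R * R) (t D : R) :
  is_derive (t *: d + x) d G D -> is_derive t 1 (fun t => G (t *: d + x)) D.
Proof.
move=> [dG <-]; have E : (fun h : R => h^-1 *: (((fun t => G (t *: d + x)) \o shift t) (h *: 1)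
     - G (t *: d + x))) = (fun h => h^-1 *: ((G \o shift (t *: d + x)) (h *: d) - G (t *: d + x))).
  apply/funext => h /=; congr (_ *: (G _ - _)).
  by rewrite scalerDl addrA; congr (_ *: _ + _ + _); rewrite /GRing.scale /= mulr1.
by apply: DeriveDef; rewrite /derivable /derive E.
Qed.

Lemma continuous_line {R : realType} (G : R * R -> R) (x d : R * R) :
  continuous G -> continuous (fun t : R => G (t *: d + x)).
Proof.
move=> cG t; apply: (@continuous_comp _ _ _ (fun t : R => t *: d + x) G); last exact: cG.
by apply: cvgD; [apply: cvgZr_tmp; exact: cvg_id|exact: cvg_cst].
Qed.

(** The mean value theorem, applied twice on the segment from x to d + x, gives
the remainder as t1 times a second derivative, with 0 < t1 < 1. *)
Lemma taylor_remainder {R : realType} (G : R * R -> R)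
    (g : 'I_2 -> R * R -> R) (H : 'I_2 -> 'I_2 -> R * R -> R) (x d : R * R) (B : R) :
  (forall x d, is_derive x d G (d.1 * g 0 x + d.2 * g 1 x)) ->
  (forall i x d, is_derive x d (g i) (d.1 * H i 0 x + d.2 * H i 1 x)) ->
  continuous G -> (forall i, continuous (g i)) ->
  (forall t, 0 <= t <= 1 -> let y := t *: d + x in
     `|d.1 * (d.1 * H 0 0 y + d.2 * H 0 1 y) + d.2 * (d.1 * H 1 0 y + d.2 * H 1 1 y)| <= B) ->
  `|G (d + x) - (G x + (d.1 * g 0 x + d.2 * g 1 x))| <= B.
Proof.
move=> DG Dg cG cg HB.
pose phi (t : R) := G (t *: d + x).
pose dphi (t : R) := d.1 * g 0 (t *: d + x) + d.2 * g 1 (t *: d + x).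
have D1 (t : R) : is_derive t (1 : R) phi (dphi t) by exact: is_derive_line.
pose ddphi (t : R) := let y := t *: d + x in
  d.1 * (d.1 * H 0 0 y + d.2 * H 0 1 y) + d.2 * (d.1 * H 1 0 y + d.2 * H 1 1 y).
have D2 (t : R) : is_derive t (1 : R) dphi (ddphi t).
  have h0 := is_deriveZ d.1 (is_derive_line (Dg 0 (t *: d + x) d)).
  have h1 := is_deriveZ d.2 (is_derive_line (Dg 1 (t *: d + x) d)).
  exact: is_deriveD h0 h1.
have cphi : continuous phi by exact: continuous_line.
have cdphi : continuous dphi.
  move=> t; apply: cvgD; apply: cvgM; try exact: cvg_cst; exact: continuous_line.
have [t1 t1I E1] := @MVT R phi dphi 0 1 ltr01 (fun t _ => D1 t) (continuous_subspaceT cphi).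
move: t1I; rewrite in_itv/= => /andP[t10 t11].
have [t2 t2I E2] := @MVT R dphi ddphi 0 t1 t10 (fun t _ => D2 t) (continuous_subspaceT cdphi).
move: t2I; rewrite in_itv/= => /andP[t20 t21].
have -> : G (d + x) = phi 1 by rewrite /phi scale1r.
have -> : G x = phi 0 by rewrite /phi scale0r add0r.
have -> : d.1 * g 0 x + d.2 * g 1 x = dphi 0 by rewrite /dphi scale0r add0r.
rewrite (_ : _ - _ = ddphi t2 * t1); last first.
  move: E1 E2; rewrite !subr0 mulr1 => E1 E2; lra.
rewrite normrM (gtr0_norm t10); have := HB t2.
rewrite (ltW t20) (ltW (lt_trans t21 t11)) => /(_ isT) /= h.
by apply: le_trans h; rewrite ler_piMr// ltW.
Qed.

(** * Simplex splines on the closed triangle *)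

Section Density.
Context {R : realType} (v1 v2 v3 : R * R).
Local Notation a := (v2 - v1).
Local Notation b := (v3 - v1).
Local Notation v := (split12 v1 v2 v3).
Hypothesis ab0 : cross a b != 0.

Lemma line_at_segment (x y : R * R) (e : R) (l : vec) :
  line_at v1 v2 v3 (x + e *: (y - x)) l =
  (1 - e) * line_at v1 v2 v3 x l + e * line_at v1 v2 v3 y l.
Proof.
have [al [be [ga H]]] := line_at_affine v1 v2 v3 l.
by rewrite !H /affine_fun /= /GRing.scale /=; ring.
Qed.

Lemma off_linesP (x : R * R) :
  (forall i j : 'I_11, (0 < i < j)%N -> line_at v1 v2 v3 x (knot_line i j) != 0) ->
  off_lines v x.
Proof.
move=> H i j ij j10 [t xE].
have iP : (0 < i <= 10)%N.
  by case/andP: ij => -> /ltnW ij; rewrite (leq_trans ij).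
have jP : (0 < j <= 10)%N by rewrite j10 andbT; case/andP: ij => _; exact: leq_ltn_trans.
have j11 : (j < 11)%N by [].
have i11 : (i < 11)%N by case/andP: iP.
have /negP := H (Ordinal i11) (Ordinal j11) ij; apply => /=.
have := cross_line_at ab0 x iP jP.
have -> : cross (v i - x) (v j - x) = 0.
  by rewrite xE /cross /= /GRing.scale /=; ring.
move=> /esym/eqP; rewrite mulf_eq0 invr_eq0 pnatr_eq0 orbF mulf_eq0.
by rewrite (negPf ab0).
Qed.

Definition generic_bary : vec := (Zpos 16, Zpos 5, Zpos 2).

(** An interior point that is on none of the lines through two vertices.  A short
segment from a point of T towards it lies, apart from that point, in the interior
and off these lines, which makes both sets dense in T. *)
Definition generic_point : R * R := from_coords v1 a b (5 / 23, 2 / 23).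

Lemma line_at_generic (l : vec) :
  line_at v1 v2 v3 generic_point l = zr (dot l generic_bary) / 23.
Proof.
rewrite /line_at from_coordsK// /ev_line; case: l => [[l1 l2] l3].
by rewrite /= !(zrD, zrM) !zrE; field.
Qed.

Lemma generic_neq0 (i j : 'I_11) : (0 < i < j)%N ->
  line_at v1 v2 v3 generic_point (knot_line i j) != 0.
Proof.
move=> ij; rewrite line_at_generic mulf_neq0 ?invr_neq0 ?pnatr_eq0//.
have H : all (fun i => all (fun j => (0 < i < j)%N ==>
    ~~ Z.eqb (dot (knot_line i j) generic_bary) Z0) (iota 0 11)) (iota 0 11).
  by vm_compute.
have mem (k : 'I_11) : (k : nat) \in iota 0 11 by rewrite mem_iota ltn_ord.
by rewrite zr_eq0; have := allP (allP H _ (mem i)) _ (mem j); rewrite ij.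
Qed.

Lemma near_segment_off_lines (x : R * R) :
  \forall e \near (0 : R)^'+, off_lines v (x + e *: (generic_point - x)).
Proof.
suff : \forall e \near (0 : R)^'+, forall ij : 'I_11 * 'I_11, (0 < ij.1 < ij.2)%N ->
    line_at v1 v2 v3 (x + e *: (generic_point - x)) (knot_line ij.1 ij.2) != 0.
  by apply: filterS => e H; apply: off_linesP => i j; exact: (H (i, j)).
apply: filter_forall => -[i j] /=.
have [ij|_] := boolP (0 < i < j)%N; last by apply: nearW.
have g0 := generic_neq0 ij.
have [x0|x0] := eqVneq (line_at v1 v2 v3 x (knot_line i j)) 0.
  near=> e => _; rewrite line_at_segment x0 mulr0 add0r; apply: mulf_neq0; last exact: g0.
  by apply: lt0r_neq0.
have : (1 - e) * line_at v1 v2 v3 x (knot_line i j) +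
    e * line_at v1 v2 v3 generic_point (knot_line i j) @[e --> (0 : R)^'+] -->
    line_at v1 v2 v3 x (knot_line i j).
  apply: cvg_at_right_filter.
  rewrite -[X in _ --> X]addr0 -[X in _ --> X + _]mul1r -[X in _ --> _ + X](mul0r
    (line_at v1 v2 v3 generic_point (knot_line i j))).
  apply: cvgD; apply: cvgM; try exact: cvg_cst; last exact: cvg_id.
  by rewrite -[X in _ --> X]subr0; apply: cvgB; [exact: cvg_cst|exact: cvg_id].
move=> /cvgr_neq0 /(_ x0); apply: filterS => e h _.
by rewrite line_at_segment.
Unshelve. all: by end_near.
Qed.

Lemma cvg_segment (x y : R * R) : x + e *: (y - x) @[e --> (0 : R)^'+] --> x.
Proof.
apply: cvg_at_right_filter.
have : x + e *: (y - x) @[e --> (0 : R)] --> x + (0 : R) *: (y - x).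
  by apply: cvgD; [exact: cvg_cst|apply: cvgZr_tmp; exact: cvg_id].
by rewrite scale0r addr0.
Qed.

Lemma triangle_lines (x : R * R) : triangle v x <->
  forall l, l \in [:: (Zpos 1, Z0, Z0); (Z0, Zpos 1, Z0); (Z0, Z0, Zpos 1)] ->
    0 <= line_at v1 v2 v3 x l.
Proof.
rewrite triangle_split12 triangle_atP// /unit_triangle /line_at /ev_line.
case: (coords v1 a b x) => s u; split => [[/= s0 u0 su1] l|H].
  by rewrite !inE => /or3P[] /eqP -> /=; rewrite !zrE; lra.
have := H (Zpos 1, Z0, Z0) (mem_head _ _).
have := H (Z0, Zpos 1, Z0); rewrite !inE eqxx orbT => /(_ isT).
have := H (Z0, Z0, Zpos 1); rewrite !inE eqxx !orbT => /(_ isT).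
by rewrite /= !zrE => h1 h2 h3; split; lra.
Qed.

Lemma continuous_line_at (l : vec) : continuous (fun x => line_at v1 v2 v3 x l).
Proof.
have [al [be [ga H]]] := line_at_affine v1 v2 v3 l.
by rewrite (_ : (fun x => _) = affine_fun al be ga); [exact: continuous_affine_fun|apply/funext].
Qed.

Lemma interior_triangle (x : R * R) :
  (forall l, l \in [:: (Zpos 1, Z0, Z0); (Z0, Zpos 1, Z0); (Z0, Z0, Zpos 1)] ->
    0 < line_at v1 v2 v3 x l) -> ((triangle v)° : set (R * R)) x.
Proof.
move=> H; rewrite /interior.
have H' l : l \in [:: (Zpos 1, Z0, Z0); (Z0, Zpos 1, Z0); (Z0, Z0, Zpos 1)] ->
    \forall y \near x, 0 < line_at v1 v2 v3 y l.
  by move=> /H h; have := @continuous_line_at l x; move/cvgr_gt; apply.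
have h1 := H' (Zpos 1, Z0, Z0) (mem_head _ _).
have h2 : \forall y \near x, 0 < line_at v1 v2 v3 y (Z0, Zpos 1, Z0).
  by apply: H'; rewrite !inE eqxx orbT.
have h3 : \forall y \near x, 0 < line_at v1 v2 v3 y (Z0, Z0, Zpos 1).
  by apply: H'; rewrite !inE eqxx !orbT.
near=> y; apply/triangle_lines => l.
by rewrite !inE => /or3P[] /eqP ->; apply: ltW; near: y.
Unshelve. all: by end_near.
Qed.

Lemma near_segment_interior (x : R * R) : triangle v x ->
  \forall e \near (0 : R)^'+,
    ((triangle v)° : set (R * R)) (x + e *: (generic_point - x)).
Proof.
move=> /triangle_lines H; near=> e; apply: interior_triangle => l lL.
have e0 : 0 < e by [].
have e1 : e < 1 by near: e; apply: nbhs_right_lt.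
rewrite line_at_segment ltr_wpDl// ?mulr_ge0 ?H ?subr_ge0 ?(ltW e1)// mulr_gt0//.
rewrite line_at_generic divr_gt0//.
by move: lL; rewrite !inE => /or3P[] /eqP ->; rewrite zr_gt0.
Unshelve. all: by end_near.
Qed.

(** By density the filter in the definition of [simplex_spline_on] is proper, so
that the limit is unique. *)
Lemma closure_off_lines (x : R * R) : triangle v x ->
  closure (triangle v `&` off_lines v) x.
Proof.
move=> xT B /(@cvg_segment x generic_point) /= xB.
have hI := near_segment_interior xT; have hO := near_segment_off_lines x.
have : \forall e \near (0 : R)^'+,
    ((triangle v `&` off_lines v) `&` B) (x + e *: (generic_point - x)).
  near=> e; split; last by near: e.
  split; last by near: e.
  by apply: interior_subset; near: e.
by move=> /filter_ex[e He]; exists (x + e *: (generic_point - x)).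
Unshelve. all: by end_near.
Qed.

(** The same for the filter in the definition of [hessian_on]. *)
Lemma closure_interior (x : R * R) : triangle v x -> closure ((triangle v)°) x.
Proof.
move=> xT B /(@cvg_segment x generic_point) /= xB.
have hI := near_segment_interior xT.
have : \forall e \near (0 : R)^'+,
    ((triangle v)° `&` B) (x + e *: (generic_point - x)).
  by near=> e; split; near: e.
by move=> /filter_ex[e He]; exists (x + e *: (generic_point - x)).
Unshelve. all: by end_near.
Qed.

Lemma simplex_spline_onE (t : table) (K : seq nat) (P : pieces) (x : R * R) :
  all (entry_ok t) t -> lookup t K = Some P -> size K = 8%N -> form_ok P ->
  triangle v x ->
  simplex_spline_on v K x =
  ev_form (coords v1 a b x).1 (coords v1 a b x).2 (cross_form P).
Proof.
move=> tok KP K8 PF xT; rewrite /simplex_spline_on.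
have PFx := within_nbhs_proper (closure_off_lines xT).
apply: cvg_lim; first exact: norm_hausdorff.
pose G y := ev_form (coords v1 a b y).1 (coords v1 a b y).2 (cross_form P).
have : G y @[y --> within (triangle v `&` off_lines v) (nbhs x)] --> G x.
  apply: cvg_within_filter.
  exact: (smooth_continuous (smooth_ev_form v1 v2 v3 (cross_form P))).
apply: cvg_trans; apply: near_eq_cvg.
by apply: filterS (withinT _ _) => y [yT yoff]; rewrite /G (simplex_splineE ab0 tok KP).
Qed.

End Density.

(** * The bases as sums of truncated powers *)

Section Representation.
Context {R : realType}.

Definition of_quarters (r : Z * seq nat * seq nat) : R * seq nat * seq nat :=
  (zr r.1.1 / 4, r.1.2, r.2).

Lemma sym_orbit_of_quarters r :
  sym_orbit (of_quarters r) = map of_quarters (quarter_orbit r).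
Proof. by case: r => [[w K] P]; rewrite /= -map_comp. Qed.

Lemma basis_dataE (s : basis_name) :
  basis_data s = map of_quarters (quarter_data s).
Proof.
rewrite /basis_data /quarter_data.
have -> : common_reps ++ specific_reps s = map of_quarters (quarter_reps s).
  have q1 : zr (Zpos 1) / 4 = 1 / 4 :> R by [].
  have q2 : zr (Zpos 2) / 4 = 1 / 2 :> R by rewrite !zrE; field.
  have q3 : zr (Zpos 3) / 4 = 3 / 4 :> R by rewrite !zrE; field.
  have q4 : zr (Zpos 4) / 4 = 1 :> R by rewrite !zrE; field.
  by case: s; rewrite /of_quarters /= ?(q1, q2, q3, q4).
rewrite map_flatten -!map_comp; congr flatten; apply: eq_map => r.
exact: sym_orbit_of_quarters.
Qed.

Definition knot_form (t : table) (K : seq nat) : seq poly2 :=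
  cross_form (odflt [::] (lookup t K)).

Lemma quarter_data_top s r : r \in quarter_data s -> r.1.2 \in top_knots.
Proof.
have : all (fun r => r.1.2 \in top_knots) (quarter_data s) by case: s; vm_compute.
by move=> /allP H /H.
Qed.

Lemma quarter_data_points s r : r \in quarter_data s ->
  size r.2 = 5%N /\ forall j, j \in r.2 -> (0 < j <= 10)%N.
Proof.
have : all (fun r => (size r.2 == 5%N) && all (fun j => 0 < j <= 10)%N r.2)
    (quarter_data s) by case: s; vm_compute.
by move=> /allP H /H /andP[/eqP -> /allP].
Qed.

Lemma size_quarter_data s : size (quarter_data s) = 39%N.
Proof. by case: s; vm_compute. Qed.

Definition quarter_elt (s : basis_name) (i : 'I_39) :=
  nth (Z0, [::], [::]) (quarter_data s) i.

Lemma basis_eltE s (i : 'I_39) : basis_elt s i = of_quarters (quarter_elt s i).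
Proof.
rewrite /basis_elt basis_dataE (nth_map (Z0, [::], [::]))//.
by rewrite size_quarter_data.
Qed.

Lemma mem_quarter_elt s (i : 'I_39) : quarter_elt s i \in quarter_data s.
Proof. by apply: mem_nth; rewrite size_quarter_data. Qed.

Lemma sum_quarter_elt s (f : Z * seq nat * seq nat -> R) :
  \sum_(i < 39) f (quarter_elt s i) = \sum_(r <- quarter_data s) f r.
Proof. by rewrite (big_nth (Z0, [::], [::])) size_quarter_data big_mkord. Qed.

(** The factors of the terms of [cross_form], the constant 1 being that of the
initial polynomial. *)
Definition cut (s u : R) (m : nat) : R :=
  if m is m'.+1 then
    Num.max (ev_line s u (nth (Z0, Z0, Z0) inner_lines m')) 0 ^+ 4
  else 1.

Lemma ev_formE (s u : R) (F : seq poly2) :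
  ev_form s u F = \sum_(m < 7) cut s u m * ev_piece s u m F.
Proof.
have E (L : seq vec) (Ps : seq poly2) (r0 : R) :
    foldr (fun lp r => Num.max (ev_line s u lp.1) 0 ^+ 4 * ev2 s u lp.2 + r) r0
      (zip L Ps) =
    r0 + \sum_(m < size L) Num.max (ev_line s u (nth (Z0, Z0, Z0) L m)) 0 ^+ 4 *
                           ev2 s u (nth [::] Ps m).
  elim: L Ps => [|l L IH] [|p Ps] /=; rewrite ?big_ord0 ?addr0//.
    by rewrite big1 ?addr0// => m _; rewrite nth_nil mulr0.
  by rewrite IH big_ord_recl /= addrCA.
rewrite /ev_form E [in RHS]big_ord_recl /= mul1r; congr (_ + _).
by apply: eq_bigr => m _; rewrite /ev_piece nth_behead.
Qed.

Lemma ev_form_eq (s u : R) (F F' : seq poly2) : eq_pieces F F' ->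
  ev_form s u F = ev_form s u F'.
Proof.
by move=> FF'; rewrite !ev_formE; apply: eq_bigr => m _; rewrite (ev_piece_eq _ _ _ FF').
Qed.

(** Addition of forms is addition of coefficients, so that identities between sums
of basis functions are identities between lists of integers. *)
Lemma ev_form_weighted_sum (t : table) (s u : R) (f : seq nat -> Z) D :
  ev_form s u (weighted_sum t f D) =
  \sum_(r <- D) zr (r.1.1) * zr (f r.2) * ev_form s u (knot_form t r.1.2).
Proof.
elim: D => [|[[w K] P] D IH]; rewrite ?big_nil ?big_cons.
  by rewrite ev_formE big1// => m _; rewrite /ev_piece nth_nil mulr0.
rewrite -IH -[weighted_sum t f (_ :: D)]/(add_pieces (scale_pieces (Z.mul w (f P))
  (knot_form t K)) (weighted_sum t f D)).
move: (weighted_sum t f D) (knot_form t K) => F F'.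
rewrite !ev_formE mulr_sumr -big_split; apply: eq_bigr => m _ /=.
by rewrite ev_piece_add ev_piece_scale zrM; ring.
Qed.

Lemma sum_ev_form (t : table) s (x y : R) : certificate t ->
  [/\ \sum_(r <- quarter_data s) zr r.1.1 / 4 * ev_form x y (knot_form t r.1.2) = 1,
      \sum_(r <- quarter_data s) zr r.1.1 / 4 * ev_form x y (knot_form t r.1.2) *
         (zr (coord12 0 r.2) / 60) = x &
      \sum_(r <- quarter_data s) zr r.1.1 / 4 * ev_form x y (knot_form t r.1.2) *
         (zr (coord12 1 r.2) / 60) = y].
Proof.
have all_bases (p : pred basis_name) : all p [:: Ba; Bb; Bc; Bd; Be; Bf] -> p s.
  by move=> /= /andP[pa /and5P[pb pc pd pe /andP[pf _]]]; case: s.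
have e1 : ev_form x y [:: [:: [:: Zpos 4]]] = 4.
  by rewrite /ev_form /= !zrE; ring.
have e2 : ev_form x y [:: [:: [::]; [:: Zpos 240]]] = 240 * x.
  by rewrite /ev_form /= !zrE; ring.
have e3 : ev_form x y [:: [:: [:: Z0; Zpos 240]]] = 240 * y.
  by rewrite /ev_form /= !zrE; ring.
move=> /and3P[_ _ /all_bases] /and3P[/(ev_form_eq x y) + /(ev_form_eq x y) + /(ev_form_eq x y)].
rewrite !ev_form_weighted_sum e1 e2 e3 => h1 h2 h3.
move: (knot_form t) h1 h2 h3 => kf h1 h2 h3; split.
- apply: (@mulfI _ 4); rewrite ?pnatr_eq0// mulr_sumr.
  rewrite (eq_bigr (fun r => zr r.1.1 * zr (Zpos 1) * ev_form x y (kf r.1.2))).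
    by rewrite h1 mulr1.
  by move=> r _; rewrite zr1; field.
- apply: (@mulfI _ 240); rewrite ?pnatr_eq0// mulr_sumr.
  rewrite (eq_bigr (fun r => zr r.1.1 * zr (coord12 0 r.2) * ev_form x y (kf r.1.2))).
    by rewrite h2.
  by move=> r _; field.
- apply: (@mulfI _ 240); rewrite ?pnatr_eq0// mulr_sumr.
  rewrite (eq_bigr (fun r => zr r.1.1 * zr (coord12 1 r.2) * ev_form x y (kf r.1.2))).
    by rewrite h3.
  by move=> r _; field.
Qed.

End Representation.

(** Everything else depends on the certificate only, and not on the entries of
the table. *)
Lemma certificate_exists : exists t, certificate t.
Proof. by exists split_table; vm_compute. Qed.

Lemma nondegenerate_cross {R : realType} (v1 v2 v3 : R * R) :
  nondegenerate_triangle v1 v2 v3 -> cross (v2 - v1) (v3 - v1) != 0.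
Proof.
rewrite /nondegenerate_triangle free_cons span_seq1 seq1_free.
move: (v2 - v1) (v3 - v1) => [a1 a2] [b1 b2] /andP[ab b0].
apply: contra ab => /eqP; rewrite /cross /= => c0; apply/vlineP.
have [b10|b10] := eqVneq b1 0; last first.
  exists (a1 / b1); apply: injective_projections; rewrite /= /GRing.scale /=.
    by field.
  by apply: (mulIf b10); rewrite mulrAC (divfK b10); lra.
have b20 : b2 != 0.
  by apply: contra b0 => /eqP b20; rewrite b10 b20.
exists (a2 / b2); apply: injective_projections; rewrite /= /GRing.scale /=.
  by apply: (mulIf b20); rewrite mulrAC (divfK b20); lra.
by field.
Qed.

(** * Geometry of the triangle and the Hessian *)

Section Triangle.
Context {R : realType} (v1 v2 v3 : R * R).
Local Notation a := (v2 - v1).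
Local Notation b := (v3 - v1).
Local Notation v := (split12 v1 v2 v3).
Hypothesis ab0 : cross a b != 0.

Lemma compact_triangle : compact (triangle v : set (R * R)).
Proof.
rewrite triangle_split12; apply: continuous_compact.
  apply: continuous_subspaceT => x; rewrite /from_coords.
  apply: cvgD; first apply: cvgD; first exact: cvg_cst.
    by apply: cvgZr_tmp; exact: cvg_fst.
  by apply: cvgZr_tmp; exact: cvg_snd.
apply: (@subclosed_compact (R * R)%type (unit_triangle : set (R * R))
  (`[0 : R, 1]%classic `*` `[0 : R, 1]%classic)).
- rewrite (_ : unit_triangle = (affine_fun 1 0 0 @^-1` [set y | 0 <= y]) `&`
    ((affine_fun 0 1 0 @^-1` [set y | 0 <= y]) `&`
     (affine_fun (- 1) (- 1) 1 @^-1` [set y | 0 <= y]))).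
    by do 2?[apply: closedI]; apply: preimage_closed; try exact: closed_ge;
       move=> x _; exact: continuous_affine_fun.
  apply/seteqP; rewrite /affine_fun; split => x /=.
    by move=> [h1 h2 h3]; split; [|split]; lra.
  by move=> [h1 [h2 h3]]; split; lra.
- by apply: compact_setX; exact: segment_compact.
- by move=> x [h1 h2 h3]; split => /=; rewrite in_itv/=; apply/andP; split; lra.
Qed.

Lemma continuous_triangle_bounded (g : R * R -> R) : continuous g ->
  exists B, forall x, triangle v x -> `|g x| <= B.
Proof.
move=> cg; have /compact_bounded[M [_ HM]] : compact (g @` triangle v).
  by apply: continuous_compact; [exact: continuous_subspaceT|exact: compact_triangle].
by exists (M + 1) => x xT; apply: (HM (M + 1)); rewrite ?ltrDl//; exists x.
Qed.

Lemma le_eucl_dist (x y : R * R) :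
  x.1 - y.1 <= eucl_dist x y /\ x.2 - y.2 <= eucl_dist x y.
Proof.
split; rewrite /eucl_dist; apply: le_trans (ler_norm _) _;
  by rewrite -sqrtr_sqr ler_wsqrtr// ?lerDl ?lerDr sqr_ge0.
Qed.

Lemma eucl_distC (x y : R * R) : eucl_dist x y = eucl_dist y x.
Proof. by rewrite /eucl_dist; congr Num.sqrt; ring. Qed.

Lemma eucl_dist_vertices (j k : nat) : j \in [:: 1; 2; 3]%N -> k \in [:: 1; 2; 3]%N ->
  eucl_dist (v j) (v k) <= longest_edge v1 v2 v3.
Proof.
have h0 : 0 <= longest_edge v1 v2 v3.
  by rewrite /longest_edge le_max /eucl_dist sqrtr_ge0.
have hxx x : eucl_dist x x <= longest_edge v1 v2 v3.
  by rewrite /eucl_dist !subrr expr0n addr0 sqrtr0.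
have h12 : eucl_dist v1 v2 <= longest_edge v1 v2 v3 by rewrite /longest_edge le_max lexx.
have h23 : eucl_dist v2 v3 <= longest_edge v1 v2 v3 by rewrite /longest_edge !le_max lexx orbT.
have h13 : eucl_dist v1 v3 <= longest_edge v1 v2 v3 by rewrite /longest_edge !le_max lexx !orbT.
by rewrite !inE => /or3P[] /eqP -> /or3P[] /eqP -> //=; rewrite eucl_distC.
Qed.

(** A coordinate of x - y is affine in x and in y separately, and therefore
maximal at two vertices. *)
Lemma triangle_diameter (x y : R * R) : triangle v x -> triangle v y ->
  x.1 - y.1 <= longest_edge v1 v2 v3 /\ x.2 - y.2 <= longest_edge v1 v2 v3.
Proof.
set h := longest_edge v1 v2 v3.
suff H (al be : R) : (forall j k, j \in [:: 1; 2; 3]%N -> k \in [:: 1; 2; 3]%N ->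
    affine_fun al be 0 (v j) - affine_fun al be 0 (v k) <= h) ->
    triangle v x -> triangle v y ->
    affine_fun al be 0 x - affine_fun al be 0 y <= h.
  move=> xT yT; split.
    have := H 1 0 _ xT yT; rewrite /affine_fun !mul1r !mul0r !addr0; apply => j k jT kT.
    rewrite !mul1r !mul0r !addr0.
    exact: le_trans (le_eucl_dist _ _).1 (eucl_dist_vertices jT kT).
  have := H 0 1 _ xT yT; rewrite /affine_fun !mul1r !mul0r !addr0 !add0r; apply => j k jT kT.
  rewrite !mul1r !mul0r !addr0 !add0r.
  exact: le_trans (le_eucl_dist _ _).2 (eucl_dist_vertices jT kT).
move=> Hv xT yT.
have Hx k : k \in [:: 1; 2; 3]%N -> affine_fun al be 0 x - affine_fun al be 0 (v k) <= h.
  move=> kT; rewrite -subr_ge0.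
  have E z : h - (affine_fun al be 0 z - affine_fun al be 0 (v k)) =
      affine_fun (- al) (- be) (h + affine_fun al be 0 (v k)) z.
    by rewrite /affine_fun; ring.
  by rewrite E; apply: (hull_affine_ge0 xT) => j jT; rewrite -E subr_ge0; exact: Hv.
rewrite -subr_ge0.
have E z : h - (affine_fun al be 0 x - affine_fun al be 0 z) =
    affine_fun al be (h - affine_fun al be 0 x) z.
  by rewrite /affine_fun; ring.
by rewrite E; apply: (hull_affine_ge0 yT) => j jT; rewrite -E subr_ge0; exact: Hx.
Qed.

Lemma hessian_near (f : R * R -> R) (G : R * R -> R) (y : R * R) :
  (forall x, triangle v x -> f x = G x) -> ((triangle v)° : set (R * R)) y ->
  hessian f y = hessian G y.
Proof.
move=> fG yT; apply/matrixP => i j; rewrite !mxE.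
have nT : \forall z \near y, ((triangle v)° : set (R * R)) z.
  by apply: open_nbhs_nbhs; split => //; exact: open_interior.
apply: near_eq_derive; apply: filterS nT => z zT.
apply: near_eq_derive.
have : \forall u \near z, ((triangle v)° : set (R * R)) u.
  by apply: open_nbhs_nbhs; split => //; exact: open_interior.
by apply: filterS => u /interior_subset; exact: fG.
Qed.

(** In the interior the Hessian of f is that of G, whose entries are continuous
everywhere.  The indices are exchanged because [H j i] is the derivative of [g j]
in direction i. *)
Lemma hessian_onE (f G : R * R -> R) (g : 'I_2 -> R * R -> R)
    (H : 'I_2 -> 'I_2 -> R * R -> R) (x : R * R) :
  (forall x, triangle v x -> f x = G x) ->
  (forall x d, is_derive x d G (d.1 * g 0 x + d.2 * g 1 x)) ->
  (forall i x d, is_derive x d (g i) (d.1 * H i 0 x + d.2 * H i 1 x)) ->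
  (forall i j, continuous (H i j)) -> triangle v x ->
  hessian_on (triangle v) f x = \matrix_(i, j) H j i x.
Proof.
move=> fG DG Dg cH xT.
have axisE (F : R * R -> R) (k : 'I_2 -> R * R -> R) (i : 'I_2) z :
    (forall x d, is_derive x d F (d.1 * k 0 x + d.2 * k 1 x)) -> 'D_(axis i) F z = k i z.
  move=> D; have [_ ->] := D z (axis i); rewrite /axis.
  case: i => [[|[|//]] ip] /=.
    by rewrite mul1r mul0r addr0; congr (k _ z); exact/val_inj.
  by rewrite mul1r mul0r add0r; congr (k _ z); exact/val_inj.
have hG y : hessian G y = \matrix_(i, j) H j i y.
  apply/matrixP => i j; rewrite !mxE.
  under eq_fun do rewrite (axisE G g j _ DG).
  exact: axisE.
rewrite /hessian_on; have PF := within_nbhs_proper (closure_interior ab0 xT).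
apply: cvg_lim; first exact: norm_hausdorff.
have : (\matrix_(i, j) H j i y : 'M[R]_2) @[y --> within (triangle v)° (nbhs x)] -->
    (\matrix_(i, j) H j i x : 'M[R]_2).
  apply: cvg_within_filter.
  have E y : (\matrix_(i, j) H j i y : 'M[R]_2) =
      (H 0 0 y *: delta_mx 0 0 + H 1 0 y *: delta_mx 0 1) +
      (H 0 1 y *: delta_mx 1 0 + H 1 1 y *: delta_mx 1 1).
    by rewrite [LHS]matrix_sum_delta !big_ord_recl !big_ord0 !addr0 !mxE;
      congr (_ *: delta_mx _ _ + _ *: delta_mx _ _ + (_ *: delta_mx _ _ + _ *: delta_mx _ _));
      try (congr (H _ _ y)); exact/val_inj.
  rewrite E; under eq_fun do rewrite E.
  by apply: cvgD; apply: cvgD; apply: cvgZr_tmp; exact: cH.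
apply: cvg_trans; apply: near_eq_cvg.
apply: filterS (withinT _ _) => y yT.
by rewrite (hessian_near fG yT) hG.
Qed.

End Triangle.

(** * Partition of unity and reproduction of affine functions *)

Section Basis.
Context {R : realType} (v1 v2 v3 : R * R).
Local Notation a := (v2 - v1).
Local Notation b := (v3 - v1).
Local Notation v := (split12 v1 v2 v3).
Local Notation cs := (coords v1 a b).
Hypothesis ab0 : cross a b != 0.
Variable (t : table).
Hypothesis t_ok : certificate t.
Variable (star : basis_name).

Definition basis_form (i : 'I_39) (x : R * R) : R :=
  let r := quarter_elt star i in
  zr r.1.1 / 4 * ev_form (cs x).1 (cs x).2 (knot_form t r.1.2).

Lemma basis_funE (i : 'I_39) (x : R * R) : triangle v x ->
  basis_fun v star i x = basis_form i x.
Proof.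
move=> xT; rewrite /basis_fun basis_eltE /basis_form.
have := quarter_data_top (mem_quarter_elt star i).
case: (quarter_elt star i) => [[w K] P] KT.
have {}KT : K \in top_knots := KT.
have /and3P[tok /allP/(_ K KT) + _] := t_ok.
case E: (lookup t K) => [Q|//] /andP[/eqP K8 Qok].
rewrite /of_quarters; congr (_ * _).
by rewrite (simplex_spline_onE ab0 tok E K8 Qok xT) /knot_form /= E.
Qed.

Lemma smooth_basis_form (i : 'I_39) : smooth 2 (basis_form i).
Proof.
by apply: smooth_mul; [exact: smooth_cst|exact: smooth_ev_form].
Qed.

Lemma coord12_cons n j P : coord12 n (j :: P) =
  Z.add (if n is 0%N then (bary12 j).1.2 else (bary12 j).2) (coord12 n P).
Proof. by rewrite /coord12 /=; case: (bary12 j) => [[? ?] ?]. Qed.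

#[local] Arguments coord12 : simpl never.

Lemma sum_nodes (P : seq nat) : (forall j, j \in P -> (0 < j <= 10)%N) ->
  \sum_(j <- P) v j = (size P)%:R *: v1 + (zr (coord12 0 P) / 12) *: a +
    (zr (coord12 1 P) / 12) *: b.
Proof.
elim: P => [|j P IH] H.
  by rewrite big_nil /coord12 /= zr0 mul0r !scale0r !addr0.
rewrite big_cons IH; last by move=> k kP; apply: H; rewrite inE kP orbT.
rewrite split12_node ?H ?mem_head// from_coordsE /node -[size (j :: P)]/(size P).+1.
rewrite !coord12_cons !zrD -natr1.
by apply: injective_projections; rewrite /= /GRing.scale /=; ring.
Qed.

(** The denominator is 60 = 5 * 12, for the average of five points. *)
Definition node_avg (i : 'I_39) : R * R :=
  let P := (quarter_elt star i).2 in (zr (coord12 0 P) / 60, zr (coord12 1 P) / 60).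

Lemma domain_pointE (i : 'I_39) :
  domain_point v star i = from_coords v1 a b (node_avg i).
Proof.
rewrite /domain_point basis_eltE /of_quarters /node_avg.
have [P5 P10] := quarter_data_points (mem_quarter_elt star i).
case: (quarter_elt star i) P5 P10 => [[w K] P] /= P5 P10.
rewrite sum_nodes// P5 from_coordsE.
by apply: injective_projections; rewrite /= /GRing.scale /=; field.
Qed.

Lemma domain_point_triangle (i : 'I_39) : triangle v (domain_point v star i).
Proof.
rewrite domain_pointE triangle_split12; exists (node_avg i) => //.
have [P5 P10] := quarter_data_points (mem_quarter_elt star i).
rewrite /node_avg; move: (quarter_elt star i).2 P5 P10 => P P5 P10.
suff [h1 h2 h3] : [/\ 0 <= zr (coord12 0 P) :> R, 0 <= zr (coord12 1 P) :> R &
    zr (coord12 0 P) + zr (coord12 1 P) <= 12 * (size P)%:R :> R].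
  by rewrite P5 in h3; split => /=; lra.
elim: P P10 {P5} => [|j P IH] H; first by split; rewrite /coord12 /= ?zr0 ?mulr0 ?addr0.
have [|k1 k2 k3] := IH; first by move=> k kP; apply: H; rewrite inE kP orbT.
have [/= n1 n2 n3] := node_in_triangle (R := R) (H j (mem_head _ _)).
rewrite !coord12_cons !zrD [size _]/= -natr1.
by split; lra.
Qed.

(** Partition of unity and reproduction of affine functions; the latter is centred
at x, as in the Taylor expansion at x. *)
Lemma sum_basis_form (x : R * R) :
  [/\ \sum_(i < 39) basis_form i x = 1,
      \sum_(i < 39) basis_form i x * (domain_point v star i - x).1 = 0 &
      \sum_(i < 39) basis_form i x * (domain_point v star i - x).2 = 0].
Proof.
have [h1 h2 h3] := sum_ev_form star (cs x).1 (cs x).2 t_ok.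
rewrite -!sum_quarter_elt in h1 h2 h3.
have {}h1 : \sum_(i < 39) basis_form i x = 1 by exact: h1.
have {}h2 : \sum_(i < 39) basis_form i x * (node_avg i).1 = (cs x).1 by exact: h2.
have {}h3 : \sum_(i < 39) basis_form i x * (node_avg i).2 = (cs x).2 by exact: h3.
have E p1 p2 : \sum_(i < 39) basis_form i x *
    (p1 * ((node_avg i).1 - (cs x).1) + p2 * ((node_avg i).2 - (cs x).2)) = 0.
  rewrite (eq_bigr (fun i => p1 * (basis_form i x * (node_avg i).1) +
      p2 * (basis_form i x * (node_avg i).2) -
      (p1 * (cs x).1 + p2 * (cs x).2) * basis_form i x)); last by move=> i _; ring.
  by rewrite sumrB big_split -!mulr_sumr h1 h2 h3; move: (cs x) => y /=; ring.
have dE i : domain_point v star i - x =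
    ((node_avg i).1 - (cs x).1) *: a + ((node_avg i).2 - (cs x).2) *: b.
  rewrite -[X in _ - X](coordsK v1 ab0 x) domain_pointE.
  move: (node_avg i) (cs x) => y z; rewrite !from_coordsE.
  by apply: injective_projections; rewrite /= /GRing.scale /=; ring.
split => //.
- rewrite -[RHS](E a.1 b.1); apply: eq_bigr => i _; congr (_ * _).
  by rewrite dE; move: (node_avg i) (cs x) => y z; rewrite /= /GRing.scale /=; ring.
- rewrite -[RHS](E a.2 b.2); apply: eq_bigr => i _; congr (_ * _).
  by rewrite dE; move: (node_avg i) (cs x) => y z; rewrite /= /GRing.scale /=; ring.
Qed.

End Basis.

(** * The error estimate *)

Section HessianBound.
Context {R : realType} (v1 v2 v3 : R * R).
Local Notation v := (split12 v1 v2 v3).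
Local Notation T := (triangle v).
Local Notation h := (longest_edge v1 v2 v3).
Hypothesis ab0 : cross (v2 - v1) (v3 - v1) != 0.
Variables (f G : R * R -> R).
Hypothesis fG : forall x, T x -> f x = G x.
Hypothesis smooth_G : smooth 2 G.
Local Notation M := (sup [set row_sum_norm (hessian_on T f x) | x in T]).

Lemma row_sum_norm_le (A : 'M[R]_2) (B : R) : 0 <= B ->
  (forall i, `|A i 0| + `|A i 1| <= B) -> row_sum_norm A <= B.
Proof.
move=> B0 AB; apply: bigmax_le => // i _.
rewrite !big_ord_recl big_ord0 addr0; apply: le_trans (AB i).
by apply: lerD; rewrite le_eqVlt; apply/orP; left; apply/eqP; congr (`|A i _|); exact/val_inj.
Qed.

Lemma row_le_row_sum_norm (A : 'M[R]_2) (i : 'I_2) : `|A i 0| + `|A i 1| <= row_sum_norm A.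
Proof.
apply: le_trans (le_bigmax _ _ i).
rewrite !big_ord_recl big_ord0 addr0.
by apply: lerD; rewrite le_eqVlt; apply/orP; left; apply/eqP; congr (`|A i _|); exact/val_inj.
Qed.

(** The remainder is a quadratic form in y - x, whose components are at most h in
absolute value, and it is thus at most h^2 times the sum of the four entries of
the Hessian, that is, of two row sums.  The supremum bounds these row sums because
the entries are continuous on the compact triangle. *)
Lemma taylor_bound_longest_edge : exists g : 'I_2 -> R * R -> R,
  forall x y, T x -> T y ->
  `|G y - (G x + ((y - x).1 * g 0 x + (y - x).2 * g 1 x))| <= 2 * h ^+ 2 * M.
Proof.
have [g [H [DG Dg cg cH]]] := smooth_hessian smooth_G.
have HE x : T x -> hessian_on T f x = \matrix_(i, j) H j i x.
  by move=> xT; exact: (hessian_onE ab0 fG DG Dg cH).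
have HM i x : T x -> `|H 0 i x| + `|H 1 i x| <= M.
  move=> xT.
  have -> : `|H 0 i x| + `|H 1 i x| =
      `|hessian_on T f x i 0| + `|hessian_on T f x i 1| by rewrite HE// !mxE.
  apply: le_trans (row_le_row_sum_norm _ i) _.
  have bH j k : exists2 B : R, 0 <= B & forall z, T z -> `|H j k z| <= B.
    have [B HB] := continuous_triangle_bounded v1 v2 v3 (cH j k).
    by exists B => //; apply: le_trans (HB x xT).
  have [k00 p00 b00] := bH 0 0; have [k01 p01 b01] := bH 0 1.
  have [k10 p10 b10] := bH 1 0; have [k11 p11 b11] := bH 1 1.
  apply: sup_upper_bound; last by exists x.
  split; first by exists (row_sum_norm (hessian_on T f x)), x.
  exists (k00 + k01 + k10 + k11) => _ [z zT <-].
  have := b00 z zT; have := b01 z zT; have := b10 z zT; have := b11 z zT => l11 l10 l01 l00.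
  apply: row_sum_norm_le; first by rewrite !addr_ge0.
  move=> j; rewrite HE// !mxE; have [-> | ->] : j = 0 \/ j = 1.
    by case: j => [[|[|//]]] jp; [left|right]; exact/val_inj.
    by lra.
  by lra.
exists g => x y xT yT; set d := y - x.
have yE : y = d + x by rewrite /d subrK.
rewrite {1}yE; apply: (taylor_remainder DG Dg (smooth_continuous smooth_G) cg).
move=> t /andP[t0 t1]; cbv zeta; set z := t *: d + x.
have zT : T z.
  rewrite (_ : z = x + t *: (y - x)); last by rewrite addrC.
  by apply: hull_convex => //; rewrite t0.
have [d1 d2] := triangle_diameter yT xT; have [d1' d2'] := triangle_diameter xT yT.
have n1 : `|d.1| <= h by rewrite ler_norml /d /=; apply/andP; split; lra.
have n2 : `|d.2| <= h by rewrite ler_norml /d /=; apply/andP; split; lra.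
move: (HM 0 z zT) (HM 1 z zT) => M0 M1.
have E (p q w : R) : `|p| <= h -> `|q| <= h -> `|p * (q * w)| <= h ^+ 2 * `|w|.
  by move=> ph qh; rewrite mulrA !normrM expr2 ler_wpM2r// ler_pM.
have h20 : 0 <= h ^+ 2 by exact: sqr_ge0.
rewrite !mulrDr.
apply: le_trans (ler_normD _ _) _; apply: le_trans (lerD (ler_normD _ _) (ler_normD _ _)) _.
apply: le_trans (lerD (lerD (E _ _ _ n1 n1) (E _ _ _ n1 n2))
  (lerD (E _ _ _ n2 n1) (E _ _ _ n2 n2))) _.
rewrite -!mulrDr (_ : 2 * h ^+ 2 * M = h ^+ 2 * (2 * M)); last by ring.
rewrite ler_wpM2l//.
by lra.
Qed.

End HessianBound.

Lemma Linfty_norm_leP {R : realType} (D : set (R * R)) (f : R * R -> R) (r : R) :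
  0 <= r ->
  (Linfty_norm D f <= r%:E)%E <->
  \forall x \ae (@lebesgue2 R), D x -> `|f x| <= r.
Proof.
move=> r0; rewrite /Linfty_norm unlock /=.
have restrict x : ((`|((f \_ D) x)%:E| <= r%:E)%E : Prop) <-> (D x -> `|f x| <= r).
  rewrite abse_EFin lee_fin patchE; case: ifPn => [/set_mem Dx|/negP nD].
    by split => [? _|/(_ Dx)].
  rewrite normr0; split => // _ Dx; case: nD; exact: mem_set.
have [m0 _] := andP (@lebesgue2_unit_triangle R).
have FF : Filter (almost_everywhere (@lebesgue2 R)) by exact: ae_filter_ringOfSetsType.
rewrite ifT; last first.
  apply: lt_le_trans m0 _; apply: le_measure => //; rewrite inE //.
  exact: measurable_unit_triangle.
split => [/ess_supP|H].
  by apply: filterS => x /restrict.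
by apply/ess_supP; apply: filterS H => x /restrict.
Qed.

Section Stability.
Context {R : realType} (star : basis_name) (K : R).
Hypothesis hK : stability_constant star K.
Context (v1 v2 v3 : R * R).
Hypothesis hv : nondegenerate_triangle v1 v2 v3.
Local Notation v := (split12 v1 v2 v3).
Local Notation T := (triangle v).

(** At a fixed x, the sum is the value of the spline whose coefficients are the
signs of the S_i(x), a vector of norm 1.  There are finitely many sign vectors,
so that one null set serves for all x. *)
Lemma ae_sum_normr_basis_fun :
  \forall x \ae (@lebesgue2 R), T x -> \sum_(i < 39) `|basis_fun v star i x| <= 1.
Proof.
pose sgn (e : {ffun 'I_39 -> bool}) : 'cV[R]_39 := \col_i (-1) ^+ e i.
have sgn1 e : `|sgn e| <= 1.
  rewrite -[`|_|]/(mx_norm _) mx_normrE; apply: bigmax_le => // -[i j] _.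
  by rewrite mxE normrX normrN1 expr1n.
have FF : Filter (almost_everywhere (@lebesgue2 R)) by exact: ae_filter_ringOfSetsType.
have : \forall x \ae (@lebesgue2 R), forall e, T x -> `|spline v star (sgn e) x| <= 1.
  apply: filter_forall => e; apply/Linfty_norm_leP => //.
  have [_ /(_ v1 v2 v3 hv (sgn e)) /andP[_ h]] := hK.
  by apply: le_trans h _; rewrite lee_fin.
apply: filterS => x H xT.
have := H [ffun i => basis_fun v star i x < 0] xT; apply: le_trans.
apply: le_trans (ler_norm _); rewrite /spline; apply: ler_sum => i _.
by rewrite !mxE ffunE [in leLHS]normrEsign.
Qed.

End Stability.

Lemma smooth_sum {R : realType} n (I : Type) (r : seq I) (F : I -> R * R -> R) :
  (forall i, smooth n (F i)) -> smooth n (fun x => \sum_(i <- r) F i x).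
Proof.
move=> sF; elim: r => [|i r IH].
  by under eq_fun do rewrite big_nil; exact: smooth_cst.
by under eq_fun do rewrite big_cons; exact: smooth_add.
Qed.

Theorem corollary1 (R : realType) (star : basis_name) (K : R)
    (hK : stability_constant star K)
    (v1 v2 v3 : R * R) (hv : nondegenerate_triangle v1 v2 v3) (c : 'cV[R]_39) :
  let v := split12 v1 v2 v3 in
  let T := triangle v in
  let h := longest_edge v1 v2 v3 in
  let f := spline v star c in
  `|c - \col_(i < 39) f (domain_point v star i)|
    <= 2 * K * h ^+ 2 * sup [set row_sum_norm (hessian_on T f x) | x in T].
Proof.
cbv zeta; set v := split12 v1 v2 v3; set T := triangle v.
set h := longest_edge _ _ _; set f := spline v star c.
set M := sup _.
have [t t_ok] := certificate_exists.
have ab0 := nondegenerate_cross hv.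
pose S := basis_form v1 v2 v3 t star.
pose xi := @domain_point R v star.
pose G x := \sum_(i < 39) c i 0 * S i x.
have SE i x : T x -> basis_fun v star i x = S i x.
  by move=> xT; exact: basis_funE.
have fG x : T x -> f x = G x.
  by move=> xT; apply: eq_bigr => i _; rewrite SE.
have sG : smooth 2 G.
  apply: smooth_sum => i; apply: smooth_mul; first exact: smooth_cst.
  exact: smooth_basis_form.
have [g Hg] := taylor_bound_longest_edge ab0 fG sG.
rewrite -/h -/T -/M in Hg.
have xiT i : T (xi i) by exact: domain_point_triangle.
have [K0 /(_ v1 v2 v3 hv)] := hK.
set d := c - _; move=> /(_ d) /andP[lowK _].
have hM0 : 0 <= 2 * h ^+ 2 * M by exact: le_trans (Hg _ _ (xiT ord0) (xiT ord0)).
have : (Linfty_norm T (spline v star d) <= (2 * h ^+ 2 * M)%:E)%E.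
  apply/Linfty_norm_leP => //.
  have FF : Filter (almost_everywhere (@lebesgue2 R)) by exact: ae_filter_ringOfSetsType.
  apply: filterS (ae_sum_normr_basis_fun hK hv) => x H xT.
  have [s1 s2 s3] := sum_basis_form ab0 t_ok star x.
  have -> : spline v star d x =
      - \sum_(i < 39) (G (xi i) - (G x + ((xi i - x).1 * g 0 x + (xi i - x).2 * g 1 x))) * S i x.
    have E : \sum_(i < 39) (G x + ((xi i - x).1 * g 0 x + (xi i - x).2 * g 1 x)) * S i x = G x.
      rewrite (eq_bigr (fun i => S i x * G x +
        (S i x * (xi i - x).1 * g 0 x + S i x * (xi i - x).2 * g 1 x))); last by move=> i _; ring.
      rewrite big_split /= big_split /= -!mulr_suml s1 s2 s3.
      by rewrite !mul0r !addr0 mul1r.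
    under eq_bigr do rewrite mulrBl.
    rewrite sumrB E opprB [in RHS]/G -sumrB; apply: eq_bigr => i _.
    by rewrite SE// !mxE fG ?mulrBl//; exact: xiT.
  rewrite normrN; apply: le_trans (ler_norm_sum _ _ _) _.
  rewrite -[leRHS]mulr1; apply: le_trans (ler_wpM2l hM0 (H xT)).
  rewrite mulr_sumr; apply: ler_sum => i _.
  by rewrite normrM SE// ler_wpM2r//; exact: Hg.
move=> /(le_trans lowK); rewrite lee_fin mulrC ler_pdivrMr// => /le_trans; apply.
by rewrite (_ : 2 * h ^+ 2 * M * K = 2 * K * h ^+ 2 * M)//; ring.
Qed.
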